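(* Consider a triangular array of experiments indexed by $T\in\mathbb N$, each run with the Sigmoid-FTRL design using a fixed sigmoid $\phi$ satisfying the Sigmoid Condition, and suppose Assumptions 1, 2 and 3 hold. Then, as $T\to\infty$, $$T\cdot\widehat{\mathrm{VB}}-T\cdot\mathrm{VB}=\mathcal O_p\big(T^{-5/12}R^{5/6}\big),$$ where $T\cdot\mathrm{VB}=4\,\mathcal E(1)\mathcal E(0)$ is the Neyman variance bound and $T\cdot\widehat{\mathrm{VB}}=4\,\widehat{\mathcal E}(1)\widehat{\mathcal E}(0)$ its estimator.
   Context: **Triangular array.** For each $T\in\mathbb N$ there are deterministic data: covariates $x_t\in\mathbb R^d$ and potential outcomes $y_t(1),y_t(0)\in\mathbb R$, $t\in[T]=\{1,\dots,T\}$ (all quantities, including $d$, may depend on $T$; the superscript $(T)$ is suppressed). The constants $c_0,c_1,c_2,c_3,\gamma_0$ below do not depend on $T$. Limits are as $T\to\infty$. **Setting.** In round $t$ a random treatment $Z_t\in\{0,1\}$ is assigned and $Y_t=y_t(Z_t)$ is observed; treatment assignment is the only randomness. $\mathcal F_t=\sigma(Z_1,\dots,Z_t)$; the design selects $p_t=\Pr(Z_t=1\mid\mathcal F_{t-1})$ and linear predictors $\beta_t(1),\beta_t(0)\in\mathbb R^d$ from the past. **Residuals and their estimators.** $\mathcal E(k)=\min_{\beta\in\mathbb R^d}\big(\frac1T\sum_{t=1}^T(y_t(k)-\langle x_t,\beta\rangle)^2\big)^{1/2}$, $k\in\{0,1\}$. Let $X$ be the $T\times d$ matrix with rows $x_t^\top$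 and $Q=I-X(X^\top X)^{-1}X^\top$ ($X^\top X$ is invertible for all $T\ge\gamma_0^2$ by Assumption 2; only such $T$ are considered). Define $$\widehat A(1)=\frac1T\sum_{t=1}^TQ_{t,t}Y_t^2\frac{\mathbf1[Z_t=1]}{p_t}+\frac1T\sum_{t=1}^T\sum_{s\ne t}Q_{t,s}Y_tY_s\frac{\mathbf1[Z_t=1,Z_s=1]}{p_tp_s},$$ $$\widehat A(0)=\frac1T\sum_{t=1}^TQ_{t,t}Y_t^2\frac{\mathbf1[Z_t=0]}{1-p_t}+\frac1T\sum_{t=1}^T\sum_{s\ne t}Q_{t,s}Y_tY_s\frac{\mathbf1[Z_t=0,Z_s=0]}{(1-p_t)(1-p_s)},$$ and $\widehat{\mathcal E}(k)=\max(\widehat A(k),0)^{1/2}$. **Assumption 1 ($0<c_0\le c_1$).** For both $k\in\{0,1\}$: $c_0\le\mathcal E(k)\le\big(\frac1T\sum_{t=1}^Ty_t(k)^4\big)^{1/4}\le c_1$. **Assumption 2 ($c_2,\gamma_0>0$).** For all $t\in[T]$ with $t\ge T^{1/2}\gamma_0$: $\sigma_{\min}\big(\frac1t\sum_{s\le t}x_sx_s^{\top}\big)\ge 1/c_2$. **Assumption 3 ($c_3>0$).** $R=\max_{t\in[T]}\|x_t\|\le c_3T^{1/4}$. **Sigmoid Condition (constants $b_1,b_2,b_3>0$).** $\phi:\mathbb R\to(0,1)$ satisfies: (1) $\phi$ is strictly increasing, $\phi(u)+\phi(-u)=1$, $\lim_{u\to+\infty}\phi(u)=1$; (2) $u\mapsto1/\phi(u)$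 and $u\mapsto1/(1-\phi(u))$ are convex; (3a) $-(1/\phi(u))'\le b_1$ for all $u\in\mathbb R$; (3b) $(1/\phi(u))''\le b_2(1+|u|)^{-3}$ for all $u\in\mathbb R$ except finitely many points; (3c) $(1/\phi(u))''\ge b_3(1+u)^{-3}$ for all $u\ge0$ except finitely many points. **Sigmoid-FTRL design.** Input: sigmoid $\phi$. Let $\psi(u)=\frac12u^2+|u|^3$ and $\Psi=\psi\circ\phi^{-1}:(0,1)\to[0,\infty)$; $R_0=1$. For $t=1,\dots,T$: observe $x_t$; set $R_t=\max(R_{t-1},\|x_t\|)$, $\eta_t=T^{-1/2}R_t^{-1}$; $\beta_t(1)=\arg\min_{\beta}\sum_{s<t}\big(Y_s\frac{\mathbf1[Z_s=1]}{p_s}-\langle x_s,\beta\rangle\big)^2+\eta_t^{-1}\|\beta\|^2$, $\ \beta_t(0)=\arg\min_{\beta}\sum_{s<t}\big(Y_s\frac{\mathbf1[Z_s=0]}{1-p_s}-\langle x_s,\beta\rangle\big)^2+\eta_t^{-1}\|\beta\|^2$; $\widehat A_{t-1}(1)=\sum_{s<t}\frac{\mathbf1[Z_s=1]}{p_s}(Y_s-\langle x_s,\beta_s(1)\rangle)^2$, $\ \widehat A_{t-1}(0)=\sum_{s<t}\frac{\mathbf1[Z_s=0]}{1-p_s}(Y_s-\langle x_s,\beta_s(0)\rangle)^2$ (these subscripted quantities are distinct from $\widehat A(1),\widehat A(0)$ above); $p_t=\arg\min_{p\in(0,1)}\frac{\widehat A_{t-1}(1)}p+\frac{\widehat A_{t-1}(0)}{1-p}+\eta_t^{-1}\Psi(p)$;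 then draw $Z_t=1$ with (conditional) probability $p_t$ and $Z_t=0$ otherwise, and observe $Y_t$. *)

(* Defs.v *)
From mathcomp Require Import all_boot all_order all_algebra.
From mathcomp Require Import all_classical all_reals all_analysis.

Set Implicit Arguments.
Unset Strict Implicit.
Unset Printing Implicit Defensive.

Import Order.TTheory GRing.Theory Num.Theory.
Import numFieldNormedType.Exports.

Local Open Scope classical_set_scope.
Local Open Scope ring_scope.

(* Conventions.  Round t, numbered from 1, is the ordinal t.-1 : 'I_T, so that the
   1-based number of a round t : 'I_T is t.+1.  The two arms are booleans, true
   being treatment (1) and false being control (0); y t k is the potential
   outcome y_t(k).  Vectors of R^d are columns. *)

Definition inner (R : realType) (d : nat) (u v : 'cV[R]_d) : R :=
  \sum_(i < d) u i 0 * v i 0.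

(* The norm `|_| of the library is the sup norm on matrices. *)
Definition enorm (R : realType) (d : nat) (u : 'cV[R]_d) : R :=
  Num.sqrt (inner u u).

Definition is_argmin (R : realType) (U : Type) (S : set U) (f : U -> R)
    (a : U) : Prop :=
  S a /\ forall b, S b -> f a <= f b.

Definition singular_values (R : realType) (d : nat) (A : 'M[R]_d) : set R :=
  [set s | 0 <= s /\ eigenvalue (A^T *m A) (s ^+ 2)].

(* For d > 0 this is a minimum over a finite nonempty set.  For d = 0 the set is
   empty and sigma_min A = 0, so the lower bound of [eigenvalue_bound] below
   excludes d = 0. *)
Definition sigma_min (R : realType) (d : nat) (A : 'M[R]_d) : R :=
  inf (singular_values A).

Definition residual (R : realType) (T d : nat) (x : 'I_T -> 'cV[R]_d)
    (y : 'I_T -> bool -> R) (k : bool) (beta : 'cV[R]_d) : R :=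
  Num.sqrt (T%:R^-1 * \sum_(t < T) (y t k - inner (x t) beta) ^+ 2).

(* The infimum is attained: this is a least squares problem. *)
Definition min_residual (R : realType) (T d : nat) (x : 'I_T -> 'cV[R]_d)
    (y : 'I_T -> bool -> R) (k : bool) : R :=
  inf (range (residual x y k)).

Definition covariate_radius (R : realType) (T d : nat) (x : 'I_T -> 'cV[R]_d) : R :=
  \big[Num.max/0]_(t < T) enorm (x t).

Definition moment_bound (R : realType) (c0 c1 : R) (T d : nat)
    (x : 'I_T -> 'cV[R]_d) (y : 'I_T -> bool -> R) : Prop :=
  forall k : bool,
    [/\ c0 <= min_residual x y k,
        min_residual x y k <=
          (T%:R^-1 * \sum_(t < T) y t k ^+ 4) `^ (4^-1)
      & (T%:R^-1 * \sum_(t < T) y t k ^+ 4) `^ (4^-1) <= c1].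

Definition eigenvalue_bound (R : realType) (c2 gamma0 : R) (T d : nat)
    (x : 'I_T -> 'cV[R]_d) : Prop :=
  forall t : 'I_T, Num.sqrt T%:R * gamma0 <= t.+1%:R ->
    c2^-1 <=
      sigma_min (t.+1%:R^-1 *: \sum_(s < T | (s <= t)%N) (x s *m (x s)^T)).

Definition radius_bound (R : realType) (c3 : R) (T d : nat)
    (x : 'I_T -> 'cV[R]_d) : Prop :=
  covariate_radius x <= c3 * T%:R `^ (4^-1).

Definition sigmoid_condition (R : realType) (b1 b2 b3 : R) (phi : R -> R) :
    Prop :=
  let g := fun u : R => (phi u)^-1 in
  let h := fun u : R => (1 - phi u)^-1 in
  [/\ (forall u, 0 < phi u < 1),
      [/\ {homo phi : u v / u < v},
          (forall u, phi u + phi (- u) = 1)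
        & phi u @[u --> +oo] --> (1 : R)],
      convex_function [set: R] (g : R -> R^o) /\
      convex_function [set: R] (h : R -> R^o)
    & [/\ (forall u, derivable g u 1 /\ - derive1 g u <= b1),
          (exists2 N : set R, finite_set N &
             forall u, ~ N u ->
               derivable (derive1 g) u 1 /\ derive1n 2 g u <= b2 * (1 + `|u|) ^- 3)
        & (exists2 N : set R, finite_set N &
             forall u, 0 <= u -> ~ N u ->
               derivable (derive1 g) u 1 /\ b3 * (1 + u) ^- 3 <= derive1n 2 g u)]].

Definition psi (R : realType) (u : R) : R := 2^-1 * u ^+ 2 + `|u| ^+ 3.

(* Only used on ]0, 1[, where pinv setT phi is the inverse of phi. *)
Definition Psi (R : realType) (phi : R -> R) (p : R) : R :=
  psi (pinv [set: R] phi p).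

(* Below, z : 'I_T -> bool is a realised assignment, p the corresponding
   sequence of treatment probabilities and beta k the predictors of arm k. *)

Definition arm_prob (R : realType) (k : bool) (q : R) : R :=
  if k then q else 1 - q.

Definition ipw (R : realType) (T : nat) (z : 'I_T -> bool) (p : 'I_T -> R)
    (k : bool) (t : 'I_T) : R :=
  (z t == k)%:R / arm_prob k (p t).

Definition observed (R : realType) (T : nat) (y : 'I_T -> bool -> R)
    (z : 'I_T -> bool) (t : 'I_T) : R := y t (z t).

Definition running_radius (R : realType) (T d : nat) (x : 'I_T -> 'cV[R]_d)
    (t : 'I_T) : R :=
  \big[Num.max/1]_(s < T | (s <= t)%N) enorm (x s).

Definition eta (R : realType) (T d : nat) (x : 'I_T -> 'cV[R]_d) (t : 'I_T) :
    R :=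
  (Num.sqrt T%:R)^-1 * (running_radius x t)^-1.

Definition ridge_objective (R : realType) (T d : nat) (x : 'I_T -> 'cV[R]_d)
    (y : 'I_T -> bool -> R) (z : 'I_T -> bool) (p : 'I_T -> R) (k : bool)
    (t : 'I_T) (b : 'cV[R]_d) : R :=
  \sum_(s < T | (s < t)%N)
     (observed y z s * ipw z p k s - inner (x s) b) ^+ 2
  + (eta x t)^-1 * enorm b ^+ 2.

Definition running_loss (R : realType) (T d : nat) (x : 'I_T -> 'cV[R]_d)
    (y : 'I_T -> bool -> R) (z : 'I_T -> bool) (p : 'I_T -> R)
    (beta : bool -> 'I_T -> 'cV[R]_d) (k : bool) (t : 'I_T) : R :=
  \sum_(s < T | (s < t)%N)
     ipw z p k s * (observed y z s - inner (x s) (beta k s)) ^+ 2.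

Definition prob_objective (R : realType) (phi : R -> R) (T d : nat)
    (x : 'I_T -> 'cV[R]_d) (y : 'I_T -> bool -> R) (z : 'I_T -> bool)
    (p : 'I_T -> R) (beta : bool -> 'I_T -> 'cV[R]_d) (t : 'I_T) (q : R) : R :=
  running_loss x y z p beta true t / q
  + running_loss x y z p beta false t / (1 - q)
  + (eta x t)^-1 * Psi phi q.

Definition sigmoid_ftrl (R : realType) (phi : R -> R) (T d : nat)
    (x : 'I_T -> 'cV[R]_d) (y : 'I_T -> bool -> R) (z : 'I_T -> bool)
    (p : 'I_T -> R) (beta : bool -> 'I_T -> 'cV[R]_d) : Prop :=
  forall t : 'I_T,
    (forall k, is_argmin [set: 'cV[R]_d] (ridge_objective x y z p k t)
                 (beta k t)) /\
    is_argmin `]0, 1[%classic (prob_objective phi x y z p beta t) (p t).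

(* The sigma-algebra generated by the assignments before round t. *)
Definition past_sigma (disp : measure_display) (Omega : measurableType disp)
    (T : nat) (Z : 'I_T -> Omega -> bool) (t : 'I_T) : set (set Omega) :=
  <<s \bigcup_(s in [set s : 'I_T | (s < t)%N])
        preimage_set_system [set: Omega] (Z s) measurable >>.

(* q is a version of the conditional probability of A given F. *)
Definition is_cond_prob (disp : measure_display) (Omega : measurableType disp)
    (R : realType) (P : probability Omega R) (F : set (set Omega))
    (A : set Omega) (q : Omega -> R) : Prop :=
  preimage_set_system [set: Omega] q measurable `<=` F /\
  forall C, F C -> (P (A `&` C) = \int[P]_(w in C) (q w)%:E)%E.

Definition sigmoid_ftrl_design (R : realType) (phi : R -> R)
    (disp : measure_display) (Omega : measurableType disp)
    (P : probability Omega R) (T d : nat) (x : 'I_T -> 'cV[R]_d)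
    (y : 'I_T -> bool -> R) (Z : 'I_T -> Omega -> bool)
    (p : 'I_T -> Omega -> R) (beta : bool -> 'I_T -> Omega -> 'cV[R]_d) :
    Prop :=
  [/\ (forall t, measurable_fun [set: Omega] (Z t)),
      (forall w, sigmoid_ftrl phi x y (fun t => Z t w) (fun t => p t w)
                   (fun k t => beta k t w))
    & (forall t, is_cond_prob P (past_sigma Z t) [set w | Z t w] (p t))].

Definition design_mx (R : realType) (T d : nat) (x : 'I_T -> 'cV[R]_d) :
    'M[R]_(T, d) :=
  \matrix_(t, i) x t i 0.

Definition resid_proj (R : realType) (T d : nat) (x : 'I_T -> 'cV[R]_d) :
    'M[R]_T :=
  let X := design_mx x in 1%:M - X *m invmx (X^T *m X) *m X^T.

(* The diagonal terms carry a single inverse probability weight. *)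
Definition hatA (R : realType) (T d : nat) (x : 'I_T -> 'cV[R]_d)
    (y : 'I_T -> bool -> R) (z : 'I_T -> bool) (p : 'I_T -> R) (k : bool) : R :=
  let Q := resid_proj x in
  let Y := observed y z in
  T%:R^-1 * (\sum_(t < T) Q t t * Y t ^+ 2 * ipw z p k t)
  + T%:R^-1 * (\sum_(t < T) \sum_(s < T | s != t)
                 Q t s * Y t * Y s * (ipw z p k t * ipw z p k s)).

Definition hat_residual (R : realType) (T d : nat) (x : 'I_T -> 'cV[R]_d)
    (y : 'I_T -> bool -> R) (z : 'I_T -> bool) (p : 'I_T -> R) (k : bool) : R :=
  Num.sqrt (Num.max (hatA x y z p k) 0).

Definition VB (R : realType) (T d : nat) (x : 'I_T -> 'cV[R]_d)
    (y : 'I_T -> bool -> R) : R :=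
  4 * min_residual x y true * min_residual x y false / T%:R.

Definition hatVB (R : realType) (T d : nat) (x : 'I_T -> 'cV[R]_d)
    (y : 'I_T -> bool -> R) (z : 'I_T -> bool) (p : 'I_T -> R) : R :=
  4 * hat_residual x y z p true * hat_residual x y z p false / T%:R.

(* W T = O_p(a T) as T tends to infinity, each W T living on its own space. *)
Definition bigOp (R : realType) (disp : nat -> measure_display)
    (Omega : forall T, measurableType (disp T))
    (P : forall T, probability (Omega T) R)
    (W : forall T, Omega T -> R) (a : nat -> R) : Prop :=
  forall eps : R, 0 < eps ->
    exists2 M : R, 0 < M &
      \forall T \near \oo,
        (P T [set w | (M * a T < `|W T w|)%R] <= eps%:E)%E.

(* Main.v *)
Require Import Defs.
From mathcomp Require Import all_boot all_order all_algebra.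
From mathcomp Require Import all_classical all_reals all_analysis.
From mathcomp Require Import ring lra.

(** Write r for the covariate radius, e_k for the least squares residual of arm k,
    pi_t for the probability of arm k in round t, and call ipw_t - 1 the weight noise
    of round t.  By [sqr_min_residual], T e_k^2 is the quadratic form of the outcomes
    in the residual projection, and T hatA is its inverse probability weighted
    estimate.  The difference is a sum of the weight noises with coefficients that are
    known one round ahead ([quadratic_form_noise]), so its second moment is governed by
    the inverse probabilities 1 / pi_t ([expect_martingale_sqr]).  Three points control
    them.

    - The probability of a round is phi u for the minimiser u of a penalised loss.
      Comparing u with u / 2 bounds sqrt T * R_t * u^4 by the loss accumulated so far,
      where R_t is the running radius, and 1 / pi_t is at most 2 + b1 |u|
      ([inv_arm_prob_le]).
    - The total loss has expectation of order T.  This is the regret of ridge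
      regression against the zero predictor ([ridge_regret]); the variance of its labels
      is proportional to 1 / pi_t, hence of the order of a fourth root of the loss, and
      only a fraction of order T^(-1/4) of that noise enters.  The resulting inequality
      between the expected loss and itself closes ([expect_total_loss_linear]).
    - The loss is therefore below lam T with probability close to 1.  Stopping the sum
      once that level is passed makes all bounds on 1 / pi_t deterministic, while
      changing nothing on that event ([hatA_error]).  Since 1 / pi_t is then of order
      (sqrt T / R_t)^(1/4) and the squared coefficients of order R_t^2, the error of
      hatA has second moment of order (r / sqrt T)^(7/4), hence at most of order
      (r / sqrt T)^(5/3), the square of the rate ([expect_stopped_error_le]).

    Chebyshev's inequality and the Lipschitz bound for the square root on [c0, oo[
    ([sqrt_perturb]) transfer this to the product of the estimated residuals.  All
    variables are functions of the treatment path, so the probabilistic part is carried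
    out with finite sums over paths ([assignment_law]), and the measure only enters
    through the masses of cylinders ([mass_law]). *)

Set Implicit Arguments.
Unset Strict Implicit.
Unset Printing Implicit Defensive.

Import Order.TTheory GRing.Theory Num.Theory.
Import numFieldNormedType.Exports.
Local Open Scope classical_set_scope.
Local Open Scope ring_scope.

(** * The sigmoid and the treatment probability it selects *)

Section Sigmoid.
Variables (R : realType) (b1 b2 b3 : R) (phi : R -> R).
Hypothesis hphi : sigmoid_condition b1 b2 b3 phi.

Lemma sigmoid_itv u : 0 < phi u < 1.
Proof. by case: hphi => + _ _ _; apply. Qed.

Lemma sigmoid_gt0 u : 0 < phi u.
Proof. by case/andP: (sigmoid_itv u). Qed.

Lemma sigmoid_lt1 u : phi u < 1.
Proof. by case/andP: (sigmoid_itv u). Qed.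

Lemma sigmoid_incr : {homo phi : u v / u < v}.
Proof. by case: hphi => _ []. Qed.

Lemma sigmoidN u : phi (- u) = 1 - phi u.
Proof. by case: hphi => _ [_ /(_ u) h _] _ _; lra. Qed.

Lemma sigmoid_le u v : u <= v -> phi u <= phi v.
Proof.
by rewrite le_eqVlt => /orP[/eqP->//|/sigmoid_incr/ltW].
Qed.

Lemma sigmoid_inj : injective phi.
Proof.
move=> u v e; case: (ltgtP u v) => // /sigmoid_incr; rewrite e ltxx //.
Qed.

Lemma inv_sigmoid0 : (phi 0)^-1 = 2.
Proof.
have h : phi 0 = 2^-1 by have := sigmoidN 0; rewrite oppr0; lra.
by rewrite h invrK.
Qed.

Lemma inv_sigmoid_ge1 u : 1 <= (phi u)^-1.
Proof. by rewrite invf_ge1 ?sigmoid_gt0// ltW ?sigmoid_lt1. Qed.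

Lemma inv_sigmoid_derivable u : derivable (fun v => (phi v)^-1) u 1.
Proof. by case: hphi => _ _ _ [/(_ u)[]]. Qed.

Lemma inv_sigmoid_lipschitz u v : u <= v ->
  (phi u)^-1 - (phi v)^-1 <= b1 * (v - u).
Proof.
move=> uv; set g := fun w => (phi w)^-1.
have dg w : derivable g w 1 by exact: inv_sigmoid_derivable.
have [w _ e] : exists2 c, c \in `[u, v] & g v - g u = derive1 g c * (v - u).
  apply: MVT_segment => //.
    by move=> w _; rewrite derive1E; apply: DeriveDef.
  apply: continuous_subspaceT => w.
  by apply: differentiable_continuous; apply/derivable1_diffP/dg.
have hw : - derive1 g w <= b1 by case: hphi => _ _ _ [/(_ w)[]].
rewrite -[X in X <= _]opprB -/(g u) -/(g v) e -mulNr.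
by apply: ler_wpM2r => //; rewrite subr_ge0.
Qed.

(** The left side is at most 2 on the positive axis; on the negative axis it grows
    at most linearly because its slope is bounded by b1. *)
Lemma inv_sigmoid_le u : 0 < b1 -> (phi u)^-1 <= 2 + b1 * `|u|.
Proof.
move=> b1_gt0; have [u0|u0] := leP u 0.
  have := inv_sigmoid_lipschitz u0; rewrite inv_sigmoid0 ler0_norm//; lra.
rewrite gtr0_norm//; apply: (@le_trans _ _ 2).
  rewrite -inv_sigmoid0 lef_pV2 ?posrE ?sigmoid_gt0//.
  exact/sigmoid_le/ltW.
by rewrite lerDl mulr_ge0 // ltW.
Qed.

(** The drop of 1 / phi over [0, 1]: convexity makes it a lower bound for the
    slope of u |-> 1 / phi (- u) on the positive axis. *)
Definition sigmoid_slope : R := 2 - (phi 1)^-1.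

Lemma sigmoid_slope_gt0 : 0 < sigmoid_slope.
Proof.
rewrite /sigmoid_slope subr_gt0 -inv_sigmoid0 ltf_pV2 ?posrE ?sigmoid_gt0//.
by apply: sigmoid_incr.
Qed.

(** Convexity at 0, seen as a barycentre of - u and 1. *)
Lemma inv_sigmoid_ge u : 0 <= u -> 2 + sigmoid_slope * u <= (phi (- u))^-1.
Proof.
move=> u0.
have u1 : 0 < 1 + u by lra.
have ht : 0 <= u / (1 + u) <= 1.
  apply/andP; split; first by apply: divr_ge0; lra.
  by rewrite ler_pdivrMr// mul1r; lra.
have [cvx _] : convex_function [set: R] ((fun w => (phi w)^-1) : R -> R^o) /\
   convex_function [set: R] ((fun w => (1 - phi w)^-1) : R -> R^o).
  by case: hphi.
have [ht0 ht1] := andP ht.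
pose t : {i01 R} := Itv01 ht0 ht1.
have := cvx t (1 : R^o) (- u : R^o); rewrite !inE => /(_ I I).
rewrite [X in phi X](_ : _ = 0); last first.
  change (u / (1 + u) * 1 + (1 - u / (1 + u)) * - u = 0 :> R).
  by field; lra.
rewrite convRE /unstable.onem /=.
rewrite inv_sigmoid0 /sigmoid_slope.
set a := (phi 1)^-1; set b := (phi (- u))^-1 => h.
have : 2 * (1 + u) <= u * a + b.
  have -> : u * a + b = (u / (1 + u) * a + (1 - u / (1 + u)) * b) * (1 + u).
    by field; lra.
  by rewrite ler_pM2r.
lra.
Qed.

(** The symmetry of phi turns the linear growth of 1 / phi (- u) into a decay
    of 1 / phi u - 1 like 1 / u. *)
Lemma inv_sigmoid_sub1 u : 0 <= u -> (sigmoid_slope * u) * ((phi u)^-1 - 1) <= 2.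
Proof.
move=> u0; have := inv_sigmoid_ge u0; rewrite sigmoidN.
have p0 := sigmoid_gt0 u; have p1 := sigmoid_lt1 u.
have k0 := sigmoid_slope_gt0.
have p2 : (phi u)^-1 <= 2.
  by rewrite -inv_sigmoid0 lef_pV2 ?posrE ?sigmoid_gt0//; apply: sigmoid_le.
move=> h; have q0 : 0 < 1 - phi u by lra.
have -> : (phi u)^-1 - 1 = (phi u)^-1 * (1 - phi u) by field; lra.
have h2 : (sigmoid_slope * u) * (1 - phi u) <= 1.
  rewrite -ler_pdivlMr// div1r; lra.
rewrite mulrCA -[X in _ <= X]mulr1; apply: ler_pM => //.
- by rewrite ltW ?invr_gt0.
- by rewrite !mulr_ge0// ltW.
Qed.

Lemma sigmoid_surj q : 0 < q < 1 -> exists u, phi u = q.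
Proof.
have kk := sigmoid_slope_gt0.
move=> /andP[q0 q1].
have cphi : continuous phi.
  move=> u; have -> : phi = (fun v => ((phi v)^-1)^-1).
    by apply/funext => v; rewrite invrK.
  apply: cvgV; first by rewrite invr_eq0 gt_eqF// sigmoid_gt0.
  have /derivable1_diffP := @inv_sigmoid_derivable u.
  exact: differentiable_continuous.
have low r : 0 < r -> exists2 u, 0 <= u & phi (- u) <= r.
  move=> r0; exists (r^-1 / sigmoid_slope).
    by rewrite divr_ge0 // ltW // invr_gt0.
  have u0 : 0 <= r^-1 / sigmoid_slope by rewrite divr_ge0 // ltW // invr_gt0.
  have := inv_sigmoid_ge u0; rewrite mulrCA divff ?gt_eqF// mulr1 => h.
  by rewrite -lef_pV2 ?posrE ?sigmoid_gt0//; lra.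
have [u u0 hu] := low q q0.
have [v v0 hv] := low (1 - q) ltac:(by rewrite subr_gt0).
have uv : - u <= v by lra.
have vq : q <= phi v by rewrite sigmoidN in hv; lra.
have [w _ hw] : exists2 c, c \in `[- u, v] & phi c = q.
  apply: IVT => //; first exact: continuous_subspaceT.
  by rewrite minElt maxElt; case: ltP (sigmoid_le uv) => *; apply/andP; split; lra.
by exists w.
Qed.

Lemma pinv_sigmoidK q : 0 < q < 1 -> phi (pinv [set: R] phi q) = q.
Proof.
move=> /sigmoid_surj[u uq]; apply: pinvK; rewrite inE; by exists u.
Qed.

Lemma pinv_sigmoid u : pinv [set: R] phi (phi u) = u.
Proof. by apply: sigmoid_inj; rewrite pinv_sigmoidK // sigmoid_itv. Qed.

Lemma psiN (u : R) : psi (- u) = psi u.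
Proof. by rewrite /psi sqrrN normrN. Qed.

(** A positive minimiser cannot be too large: moving from u to u / 2 lowers the
    penalty by at least (7/8) lam u ^ 3, does not increase the term in B, and
    increases the term in A by at most a multiple of A / u.  This decay of
    1 / phi - 1 is what gives the fourth power of u instead of the square. *)
Lemma sigmoid_argmin_pos (A B lam u : R) : 0 <= A -> 0 <= B -> 0 <= lam ->
  0 <= u ->
  (forall v, A / phi u + B / (1 - phi u) + lam * psi u <=
             A / phi v + B / (1 - phi v) + lam * psi v) ->
  lam * u ^+ 4 <= 5 / sigmoid_slope * A.
Proof.
move=> A0 B0 l0 u0 /(_ (u / 2)).
have k0 := sigmoid_slope_gt0.
have hB : (1 - phi (u / 2))^-1 <= (1 - phi u)^-1.
  by rewrite -!sigmoidN lef_pV2 ?posrE ?sigmoid_gt0//; apply: sigmoid_le; lra.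
have hB' : B / (1 - phi (u / 2)) <= B / (1 - phi u) by rewrite ler_wpM2l.
have hA : A * ((phi (u / 2))^-1 - 1) >= A * ((phi (u / 2))^-1 - (phi u)^-1).
  by rewrite ler_wpM2l// lerB// inv_sigmoid_ge1.
have u20 : 0 <= u / 2 by lra.
have := inv_sigmoid_sub1 u20.
move: hA hB'; set g2 := (phi (u / 2))^-1; set g := (phi u)^-1.
set B1 := B / _; set B2 := B / _ => hA hB' h1 h2.
have e : psi u - psi (u / 2) = 3 / 8 * u ^+ 2 + 7 / 8 * u ^+ 3.
  by rewrite /psi !ger0_norm//; field.
have h3 : lam * (7 / 8 * u ^+ 3) <= A * (g2 - 1).
  apply: (@le_trans _ _ (lam * (psi u - psi (u / 2)))).
    by rewrite e ler_wpM2l// lerDr mulr_ge0// sqr_ge0.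
  lra.
have h4 : lam * (7 / 8 * u ^+ 3) * (sigmoid_slope * u) <= 4 * A.
  apply: (@le_trans _ _ (A * (g2 - 1) * (sigmoid_slope * u))).
    by rewrite ler_wpM2r// mulr_ge0// ltW.
  have -> : A * (g2 - 1) * (sigmoid_slope * u) =
     2 * A * (sigmoid_slope * (u / 2) * (g2 - 1)) by field.
  by rewrite [4 * A](_ : _ = 2 * A * 2); [rewrite ler_wpM2l// mulr_ge0|ring].
rewrite mulrAC ler_pdivlMr//.
have h5 : lam * (7 / 8 * u ^+ 3) * (sigmoid_slope * u) =
  7 / 8 * (lam * u ^+ 4 * sigmoid_slope) by ring.
rewrite h5 in h4; lra.
Qed.

Lemma sigmoid_argmin (A B lam u : R) : 0 <= A -> 0 <= B -> 0 <= lam ->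
  (forall v, A / phi u + B / (1 - phi u) + lam * psi u <=
             A / phi v + B / (1 - phi v) + lam * psi v) ->
  lam * u ^+ 4 <= 5 / sigmoid_slope * (A + B).
Proof.
move=> A0 B0 l0 h; have k0 := sigmoid_slope_gt0.
have k50 : 0 <= 5 / sigmoid_slope by rewrite divr_ge0// ltW.
have [u0|u0] := leP 0 u.
  apply: le_trans (sigmoid_argmin_pos A0 B0 l0 u0 h) _.
  by rewrite ler_wpM2l// lerDl.
have nu0 : 0 <= - u by lra.
have -> : u ^+ 4 = (- u) ^+ 4 by ring.
apply: le_trans (sigmoid_argmin_pos B0 A0 l0 nu0 _) _; last first.
  by rewrite ler_wpM2l// lerDr.
move=> v; have := h (- v).
rewrite !sigmoidN !psiN !opprB !(addrCA 1) !subrr !addr0.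
by rewrite (addrC (B / _)) (addrC (B / phi v)).
Qed.

(** The form in which the design is used: the inverse probabilities of both arms
    are controlled by a single u whose fourth power is bounded by the losses. *)
Lemma inv_arm_prob_le (A B lam q : R) : 0 < b1 -> 0 <= A -> 0 <= B -> 0 <= lam ->
  is_argmin `]0, 1[%classic
    (fun q => A / q + B / (1 - q) + lam * Psi phi q) q ->
  exists u, [/\ 0 <= u, lam * u ^+ 4 <= 5 / sigmoid_slope * (A + B)
     & forall k, (arm_prob k q)^-1 <= 2 + b1 * u].
Proof.
move=> b10 A0 B0 l0 [/=]; rewrite in_itv /= => q01 hq.
pose u := pinv [set: R] phi q; have qE : phi u = q by exact: pinv_sigmoidK.
exists `|u|; split => //.
  rewrite -normrX ger0_norm; last by rewrite (exprM u 2 2) sqr_ge0.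
  apply: sigmoid_argmin => // v.
  have := hq (phi v); rewrite /= in_itv /= sigmoid_itv => /(_ isT).
  by rewrite -qE /Psi !pinv_sigmoid.
case; rewrite /arm_prob -qE; first exact: inv_sigmoid_le.
by rewrite -sigmoidN -normrN; exact: inv_sigmoid_le.
Qed.

End Sigmoid.

(** * Least squares algebra and the regret of online ridge regression *)

Section Ridge.
Variable R : realType.

(** The source of every Cauchy-Schwarz inequality below, and, with a = 0, of the
    first order condition at the minimum of a quadratic. *)
Lemma quad_discriminant (a b c : R) : 0 <= c ->
  (forall r, 0 <= a + 2 * b * r + c * r ^+ 2) -> b ^+ 2 <= a * c.
Proof.
rewrite le_eqVlt => /orP[/eqP<-|c0] h; last first.
  have := h (- b / c).
  have -> : a + 2 * b * (- b / c) + c * (- b / c) ^+ 2 = a - b ^+ 2 / c.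
    by field; lra.
  by rewrite subr_ge0 ler_pdivrMr.
have [->|b0] := eqVneq b 0; first by rewrite expr0n mulr0.
have := h (- (a + 1) / (2 * b)).
have -> : a + 2 * b * (- (a + 1) / (2 * b)) + 0 * (- (a + 1) / (2 * b)) ^+ 2 = -1.
  by field.
lra.
Qed.

Lemma sum_cauchy_schwarz (I : finType) (Q : pred I) (f g : I -> R) :
  (\sum_(i | Q i) f i * g i) ^+ 2 <=
  (\sum_(i | Q i) f i ^+ 2) * (\sum_(i | Q i) g i ^+ 2).
Proof.
apply: quad_discriminant => [|r]; first by apply: sumr_ge0 => *; exact: sqr_ge0.
have -> : \sum_(i | Q i) f i ^+ 2 + 2 * (\sum_(i | Q i) f i * g i) * r +
    (\sum_(i | Q i) g i ^+ 2) * r ^+ 2 = \sum_(i | Q i) (f i + r * g i) ^+ 2.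
  rewrite mulr_sumr !mulr_suml -!big_split /=; apply: eq_bigr => i _; ring.
by apply: sumr_ge0 => *; exact: sqr_ge0.
Qed.

Section Inner.
Variable d : nat.
Implicit Types u v w : 'cV[R]_d.

Lemma innerDr u v w : inner u (v + w) = inner u v + inner u w.
Proof. by rewrite -big_split; apply: eq_bigr => i _; rewrite mxE mulrDr. Qed.

Lemma innerZr u a v : inner u (a *: v) = a * inner u v.
Proof. by rewrite mulr_sumr; apply: eq_bigr => i _; rewrite mxE mulrCA. Qed.

Lemma innerC u v : inner u v = inner v u.
Proof. by apply: eq_bigr => i _; rewrite mulrC. Qed.

Lemma inner0r u : inner u 0 = 0.
Proof. by rewrite -(scale0r 0) innerZr mul0r. Qed.

Lemma innerDl u v w : inner (v + w) u = inner v u + inner w u.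
Proof. by rewrite !(innerC _ u) innerDr. Qed.

Lemma innerZl u a v : inner (a *: v) u = a * inner v u.
Proof. by rewrite !(innerC _ u) innerZr. Qed.

Lemma inner_ge0 u : 0 <= inner u u.
Proof. by apply: sumr_ge0 => i _; rewrite -expr2 sqr_ge0. Qed.

Lemma inner_eq0 u : inner u u = 0 -> u = 0.
Proof.
move=> /eqP; rewrite psumr_eq0 => [/allP h|i _]; last by rewrite -expr2 sqr_ge0.
apply/colP => i; rewrite mxE.
by have := h i (mem_index_enum i); rewrite /= -expr2 sqrf_eq0 => /eqP.
Qed.

Lemma inner_cauchy_schwarz u v : inner u v ^+ 2 <= inner u u * inner v v.
Proof.
have := sum_cauchy_schwarz xpredT (fun i => u i 0) (fun i => v i 0).
by rewrite /inner; under [X in _ <= X * _]eq_bigr do rewrite expr2;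
  under [X in _ <= _ * X]eq_bigr do rewrite expr2.
Qed.

Lemma sqr_enorm u : enorm u ^+ 2 = inner u u.
Proof. by rewrite sqr_sqrtr ?inner_ge0. Qed.

Lemma enorm_ge0 u : 0 <= enorm u.
Proof. exact: sqrtr_ge0. Qed.

End Inner.

(** On the segment from a to b the objective is a quadratic whose linear part
    vanishes by minimality; its second order part contains the penalty. *)
Lemma ridge_argmin_strong (I : finType) (Q : pred I) (d : nat)
    (x : I -> 'cV[R]_d) (v : I -> R) (lam : R) (a b : 'cV[R]_d) :
  let F c := \sum_(s | Q s) (v s - inner (x s) c) ^+ 2 + lam * enorm c ^+ 2 in
  0 <= lam -> is_argmin [set: 'cV[R]_d] F a ->
  F a + lam * inner (b - a) (b - a) <= F b.
Proof.
move=> F lam0 [_ amin].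
have [e ->] : exists e, b = a + e by exists (b - a); rewrite addrC subrK.
rewrite (_ : a + e - a = e); last by rewrite addrAC subrr add0r.
pose L := \sum_(s | Q s) - (v s - inner (x s) a) * inner (x s) e + lam * inner a e.
pose N := \sum_(s | Q s) inner (x s) e ^+ 2 + lam * inner e e.
have FE r : F (a + r *: e) = F a + 2 * L * r + N * r ^+ 2.
  rewrite /F !sqr_enorm /L /N !innerDr !innerZr !innerDl !innerZl (innerC e a).
  have -> : \sum_(s | Q s) (v s - inner (x s) (a + r *: e)) ^+ 2 =
      \sum_(s | Q s) (v s - inner (x s) a) ^+ 2
      + 2 * (\sum_(s | Q s) - (v s - inner (x s) a) * inner (x s) e) * r
      + (\sum_(s | Q s) inner (x s) e ^+ 2) * r ^+ 2.
    rewrite mulr_sumr !mulr_suml -!big_split /=; apply: eq_bigr => s _.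
    by rewrite innerDr innerZr; ring.
  by ring.
have sumN0 : 0 <= \sum_(s | Q s) inner (x s) e ^+ 2.
  by apply: sumr_ge0 => *; exact: sqr_ge0.
have N0 : 0 <= N by rewrite addr_ge0// mulr_ge0// inner_ge0.
have L0 : L = 0.
  apply/eqP; rewrite -sqrf_eq0 eq_le sqr_ge0 andbT -(mul0r N).
  apply: quad_discriminant => // r.
  have := amin (a + r *: e) Logic.I; rewrite FE; lra.
by have := FE 1; rewrite scale1r L0 => ->; rewrite /N; lra.
Qed.

Lemma ridge_argmin_unique (I : finType) (Q : pred I) (d : nat)
    (x : I -> 'cV[R]_d) (v : I -> R) (lam : R) (a b : 'cV[R]_d) :
  let F c := \sum_(s | Q s) (v s - inner (x s) c) ^+ 2 + lam * enorm c ^+ 2 in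
  0 < lam -> is_argmin [set: 'cV[R]_d] F a -> is_argmin [set: 'cV[R]_d] F b ->
  a = b.
Proof.
move=> F l0 ha [_ /(_ a Logic.I)].
have h1 : F a + lam * inner (b - a) (b - a) <= F b.
  exact: ridge_argmin_strong (ltW l0) ha.
rewrite -/(F a) -/(F b) => h2.
have : lam * inner (b - a) (b - a) <= 0 by lra.
rewrite pmulr_rle0// => h3; have h4 := inner_ge0 (b - a).
by apply/esym/eqP; rewrite -subr_eq0; apply/eqP/inner_eq0; lra.
Qed.

Lemma sum_ord_ltS (T : nat) (t : 'I_T) (f : 'I_T -> R) :
  \sum_(s < T | (s < t.+1)%N) f s = \sum_(s < T | (s < t)%N) f s + f t.
Proof.
rewrite (bigD1 t) //= addrC; congr (_ + _); apply: eq_bigl => s.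
rewrite ltnS leq_eqVlt -val_eqE /=; case: eqP => [->|_]; by rewrite ?ltnn ?andbT.
Qed.

(** Regret against the zero predictor.  The minimum of the round t objective is at
    most that of the next one, and the gain is at least (1 - h) times the squared
    error of round t: strong convexity charges lam t |b - beta t|^2 for leaving
    beta t, while changing the prediction by a costs a^2 / h by the bound on
    |x t|. *)
Lemma ridge_regret (T d : nat) (x : 'I_T -> 'cV[R]_d) (v lam : 'I_T -> R)
    (beta : 'I_T -> 'cV[R]_d) (h : R) :
  0 < h -> (forall t, 0 < lam t) ->
  (forall s t : 'I_T, (s <= t)%N -> lam s <= lam t) ->
  (forall t, enorm (x t) ^+ 2 <= h * lam t) ->
  (forall t : 'I_T, is_argmin [set: 'cV[R]_d]
     (fun b => \sum_(s < T | (s < t)%N) (v s - inner (x s) b) ^+ 2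
               + lam t * enorm b ^+ 2) (beta t)) ->
  (1 - h) * \sum_t (v t - inner (x t) (beta t)) ^+ 2 <= \sum_t v t ^+ 2.
Proof.
move=> h0 l0 lmono hx hbeta.
pose r t := v t - inner (x t) (beta t).
(* Any penalty that dominates the past ones is allowed, so that the induction
   survives their growth. *)
have main n : (n <= T)%N -> forall l b, 0 <= l ->
    (forall s : 'I_T, (s < n)%N -> lam s <= l) ->
    (1 - h) * (\sum_(s < T | (s < n)%N) r s ^+ 2) <=
    \sum_(s < T | (s < n)%N) (v s - inner (x s) b) ^+ 2 + l * enorm b ^+ 2.
  elim: n => [|n IH] nT l b l_ge0 hl.
    by rewrite !big_pred0// mulr0 add0r mulr_ge0// sqr_ge0.
  pose t := Ordinal nT.
  rewrite (sum_ord_ltS t) (sum_ord_ltS t (fun s => (v s - inner (x s) b) ^+ 2)) /=.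
  have ih := IH (ltnW nT) (lam t) (beta t) (ltW (l0 t)) (fun s hs => lmono s t (ltnW hs)).
  have st := ridge_argmin_strong b (ltW (l0 t)) (hbeta t).
  have ll : lam t * enorm b ^+ 2 <= l * enorm b ^+ 2.
    by rewrite ler_wpM2r ?sqr_ge0// hl//=.
  have step : (1 - h) * r t ^+ 2 <= (v t - inner (x t) b) ^+ 2
      + lam t * inner (b - beta t) (b - beta t).
    set e := b - beta t.
    have -> : v t - inner (x t) b = r t - inner (x t) e.
      have -> : b = beta t + e by rewrite addrC subrK.
      by rewrite innerDr /r; ring.
    set w := inner (x t) e.
    have w2 : w ^+ 2 <= h * (lam t * inner e e).
      apply: le_trans (inner_cauchy_schwarz _ _) _.
      by rewrite -sqr_enorm mulrA ler_wpM2r ?inner_ge0.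
    have w2h : w ^+ 2 / h <= lam t * inner e e by rewrite ler_pdivrMr// mulrC.
    have -> : (1 - h) * r t ^+ 2 = (r t - w) ^+ 2 + w ^+ 2 / h
       - (h * (r t - w / h) ^+ 2 + w ^+ 2).
      by field; lra.
    have : 0 <= h * (r t - w / h) ^+ 2 + w ^+ 2.
      by rewrite addr_ge0 ?sqr_ge0// mulr_ge0 ?sqr_ge0// ltW.
    lra.
  by rewrite mulrDr; rewrite /= in ih st *; lra.
have := main T (leqnn T) (\sum_t lam t) 0.
rewrite sumr_ge0 => [|t _]; last exact/ltW/l0.
have e (f : 'I_T -> R) : \sum_(s < T | (s < T)%N) f s = \sum_s f s.
  by apply: eq_bigl => s; rewrite ltn_ord.
rewrite !e sqr_enorm inner0r mulr0 addr0 => /(_ isT).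
have -> : \sum_(s < T) (v s - inner (x s) 0) ^+ 2 = \sum_t v t ^+ 2.
  by apply: eq_bigr => s _; rewrite inner0r subr0.
apply => s _; rewrite (bigD1 s)//= lerDl sumr_ge0// => t _; exact/ltW/l0.
Qed.

End Ridge.

(** * Singular values, the hat matrix and the least squares residual *)

Section LeastSquares.
Variable R : realType.

Lemma inner_mulmx (d : nat) (u v : 'cV[R]_d) : inner u v = (u^T *m v) 0 0.
Proof. by rewrite mxE; apply: eq_bigr => i _; rewrite mxE. Qed.

Lemma inner_adj (m d : nat) (A : 'M[R]_(m, d)) (u : 'cV[R]_m) (v : 'cV[R]_d) :
  inner u (A *m v) = inner (A^T *m u) v.
Proof. by rewrite !inner_mulmx trmx_mul trmxK mulmxA. Qed.

Lemma inner_mulmx_le (m d : nat) (A : 'M[R]_(m, d)) :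
  exists2 K, 0 < K & forall v : 'cV[R]_d, inner (A *m v) (A *m v) <= K * inner v v.
Proof.
exists (\sum_i \sum_j A i j ^+ 2 + 1).
  by rewrite ltr_wpDl// sumr_ge0// => i _; apply: sumr_ge0 => j _; exact: sqr_ge0.
move=> v; rewrite mulrDl mul1r -[X in X <= _]addr0 lerD ?inner_ge0//.
rewrite /inner mulr_suml; apply: ler_sum => i _; rewrite mxE -expr2.
exact: (sum_cauchy_schwarz xpredT (fun j => A i j) (fun j => v j 0)).
Qed.

Lemma psd_cauchy_schwarz (d : nat) (B : 'M[R]_d) (u v : 'cV[R]_d) :
  B^T = B -> (forall w, 0 <= inner w (B *m w)) ->
  inner u (B *m v) ^+ 2 <= inner u (B *m u) * inner v (B *m v).
Proof.
move=> Bs B0; apply: quad_discriminant => // r.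
have := B0 (u + r *: v).
rewrite mulmxDr -scalemxAr !innerDr !innerDl !innerZr !innerZl.
rewrite (inner_adj B v u) Bs (innerC (B *m v) u).
by congr (_ <= _); ring.
Qed.

(** Let m be the infimum of |A v|^2 / |v|^2.  The form of B = A^T A - m is
    nonnegative; were B invertible, it would be bounded below by a positive
    multiple of |v|^2 and m could be increased.  So m is an eigenvalue of A^T A,
    and its root is a singular value. *)
Lemma sigma_min_stretch (d : nat) (A : 'M[R]_d) (c : R) : 0 < c ->
  c <= sigma_min A ->
  (0 < d)%N /\ forall v, c ^+ 2 * inner v v <= inner (A *m v) (A *m v).
Proof.
move=> c0 cA.
have lbs : has_lbound (singular_values A) by exists 0 => s [].
have d0 : (0 < d)%N.
  rewrite lt0n; apply/eqP => d0; move: cA; rewrite /sigma_min.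
  suff -> : singular_values A = set0 by rewrite inf0 leNgt c0.
  rewrite -subset0 => s [_ /eigenvalueP[v _ /eqP]]; apply.
  by apply/rowP => i; have := ltn_ord i; rewrite {2}d0.
split=> //.
pose S := [set r | exists2 v : 'cV[R]_d, v != 0 &
                     r = inner (A *m v) (A *m v) / inner v v].
have n0 (v : 'cV[R]_d) : v != 0 -> 0 < inner v v.
  move=> v0; rewrite lt_neqAle inner_ge0 andbT eq_sym.
  by apply: contra_neq v0 => /inner_eq0.
have lbS : has_lbound S.
  by exists 0 => r [v v0 ->]; rewrite divr_ge0 ?inner_ge0.
have S0 : S !=set0.
  pose v : 'cV[R]_d := const_mx 1.
  exists (inner (A *m v) (A *m v) / inner v v); exists v => //.
  apply/eqP => /colP /(_ (Ordinal d0)); rewrite !mxE => /eqP; by rewrite oner_eq0.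
pose m := inf S.
have m0 : 0 <= m by apply: lb_le_inf => // r [v v0 ->]; rewrite divr_ge0 ?inner_ge0.
have hm v : m * inner v v <= inner (A *m v) (A *m v).
  have [->|v0] := eqVneq v 0; first by rewrite inner0r mulr0 inner_ge0.
  by rewrite -ler_pdivlMr ?n0//; apply: ge_inf => //; exists v.
suff eig : exists2 v : 'rV[R]_d, v *m (A^T *m A) = m *: v & v != 0.
  have : sigma_min A <= Num.sqrt m.
    apply: ge_inf => //; split; first exact: sqrtr_ge0.
    by rewrite sqr_sqrtr//; apply/eigenvalueP.
  move=> /(le_trans cA) cm v; apply: le_trans (hm v).
  rewrite ler_wpM2r ?inner_ge0//.
  by rewrite -(sqr_sqrtr m0) ler_pXn2r// ?nnegrE ?sqrtr_ge0// ltW.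
pose B := A^T *m A - m%:M.
have Bsym : B^T = B by rewrite linearB /= trmx_mul trmxK tr_scalar_mx.
have qB v : inner v (B *m v) = inner (A *m v) (A *m v) - m * inner v v.
  rewrite mulmxBl mul_scalar_mx -mulmxA -scaleN1r !innerDr !innerZr (inner_adj A^T) trmxK.
  by ring.
have qB0 v : 0 <= inner v (B *m v) by rewrite qB subr_ge0.
have /det0P[v v0 vB] : \det B == 0.
  apply/negPn/negP => detB; have uB : B \in unitmx by rewrite unitmxE unitfE.
  have [K1 K10 hK1] := inner_mulmx_le (invmx B).
  have [K2 K20 hK2] := inner_mulmx_le B.
  have qle w : inner w (B *m w) <= (K2 + 1) * inner w w.
    have w0 := inner_ge0 w.
    rewrite -(@ler_pXn2r _ 2) ?nnegrE//; last by rewrite mulr_ge0//; lra.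
    apply: le_trans (inner_cauchy_schwarz _ _) _.
    apply: (@le_trans _ _ (inner w w * (K2 * inner w w))).
      by rewrite ler_wpM2l// hK2.
    have -> : inner w w * (K2 * inner w w) = K2 * inner w w ^+ 2 by ring.
    by rewrite exprMn ler_wpM2r ?sqr_ge0//; nra.
  have Ble w : inner (B *m w) (B *m w) <= (K2 + 1) * inner w (B *m w).
    have b0 := inner_ge0 (B *m w).
    have [/eqP bz|bp] := boolP (inner (B *m w) (B *m w) == 0).
      by rewrite bz mulr_ge0//; lra.
    have {bp}b0 : 0 < inner (B *m w) (B *m w) by rewrite lt_neqAle eq_sym bp b0.
    rewrite -(ler_pM2l b0) -expr2.
    apply: le_trans (psd_cauchy_schwarz (B *m w) w Bsym qB0) _.
    by rewrite mulrCA mulrA ler_wpM2r.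
  have wle w : inner w w <= K1 * (K2 + 1) * inner w (B *m w).
    rewrite -[X in inner X X](mulKmx uB w); apply: le_trans (hK1 _) _.
    by rewrite -mulrA ler_wpM2l// ltW.
  have KK : 0 < K1 * (K2 + 1) by rewrite mulr_gt0//; lra.
  have : m + (K1 * (K2 + 1))^-1 <= m.
    apply: lb_le_inf => // r [v v0 ->].
    rewrite ler_pdivlMr ?n0// mulrDl -lerBrDl -qB mulrC ler_pdivrMr// mulrC.
    exact: wle.
  by rewrite gerDl leNgt invr_gt0 KK.
exists v => //; apply/eqP; rewrite -subr_eq0 -mul_mx_scalar -mulmxBr.
by rewrite -/B vB.
Qed.

Section Design.
Variables (T d : nat) (x : 'I_T -> 'cV[R]_d) (c2 : R).
Hypothesis T0 : (0 < T)%N.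
Hypothesis c20 : 0 < c2.
Hypothesis hs : c2^-1 <= sigma_min (T%:R^-1 *: \sum_(s < T) (x s *m (x s)^T)).

Let X := design_mx x.
Let G := X^T *m X.

Lemma gram_sum : G = \sum_s x s *m (x s)^T.
Proof.
apply/matrixP => i j; rewrite mxE summxE; apply: eq_bigr => s _.
by rewrite !mxE big_ord1 !mxE.
Qed.

Lemma gram_sym : G^T = G.
Proof. by rewrite trmx_mul trmxK. Qed.

Lemma dim_gt0 : (0 < d)%N.
Proof. by have [] := sigma_min_stretch _ hs; rewrite ?invr_gt0. Qed.

Lemma gram_stretch v :
  inner v v <= (c2 / T%:R) ^+ 2 * inner (G *m v) (G *m v).
Proof.
have T0' : (0 : R) < T%:R by rewrite ltr0n.
have [|_ /(_ v)] := sigma_min_stretch _ hs; first by rewrite invr_gt0.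
rewrite -gram_sum -scalemxAl !innerZr !innerZl => h.
rewrite (_ : inner v v = c2 ^+ 2 * (c2^-1 ^+ 2 * inner v v)); last first.
  by field; rewrite gt_eqF.
rewrite (_ : _ * inner (G *m v) _ =
    c2 ^+ 2 * (T%:R^-1 * (T%:R^-1 * inner (G *m v) (G *m v)))); last first.
  by field; rewrite gt_eqF.
by rewrite ler_wpM2l// sqr_ge0.
Qed.

Lemma gram_unit : G \in unitmx.
Proof.
rewrite unitmxE unitfE; apply/det0P => -[v v0 vG].
have : inner v^T v^T <= 0.
  have := gram_stretch v^T; rewrite -[G]gram_sym -trmx_mul vG trmx0.
  by rewrite inner0r mulr0.
move=> h; have /inner_eq0 vT0 : inner v^T v^T = 0.
  by apply/eqP; rewrite eq_le h inner_ge0.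
by move/eqP: v0; apply; rewrite -[v]trmxK vT0 trmx0.
Qed.

Lemma invgram_le w : inner (invmx G *m w) (invmx G *m w) <= (c2 / T%:R) ^+ 2 * inner w w.
Proof. by have := gram_stretch (invmx G *m w); rewrite mulKVmx ?gram_unit. Qed.

Definition hat_mx : 'M[R]_T := X *m invmx G *m X^T.

Lemma resid_projE : resid_proj x = 1%:M - hat_mx.
Proof. by []. Qed.

Lemma resid_entry s t : resid_proj x t s = (t == s)%:R - hat_mx t s.
Proof. by rewrite resid_projE mxE [X in X + _]mxE [X in _ + X]mxE. Qed.

Lemma design_mulmx (b : 'cV[R]_d) t : (X *m b) t 0 = inner (x t) b.
Proof. by rewrite mxE; apply: eq_bigr => i _; rewrite mxE. Qed.

Lemma hat_entry s t : hat_mx t s = inner (x t) (invmx G *m x s).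
Proof.
rewrite -design_mulmx mulmxA !mxE; apply: eq_bigr => i _.
by rewrite !mxE.
Qed.

(** The entry is the inner product of x t with the inverse Gram matrix applied to
    x s, and that inverse contracts by c2 / T. *)
Lemma hat_entry_le s t :
  hat_mx t s ^+ 2 <= (c2 / T%:R) ^+ 2 * (enorm (x t) ^+ 2 * enorm (x s) ^+ 2).
Proof.
rewrite hat_entry !sqr_enorm; apply: le_trans (inner_cauchy_schwarz _ _) _.
by rewrite mulrCA ler_wpM2l ?inner_ge0// invgram_le.
Qed.

Lemma hat_sym : hat_mx^T = hat_mx.
Proof. by rewrite !trmx_mul trmxK trmx_inv gram_sym mulmxA. Qed.

Lemma hat_symE s t : hat_mx s t = hat_mx t s.
Proof. by rewrite -[in LHS]hat_sym mxE. Qed.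

Lemma hat_idem : hat_mx *m hat_mx = hat_mx.
Proof.
rewrite /hat_mx !mulmxA -(mulmxA _ X^T X) -/G -(mulmxA _ (invmx G) G).
by rewrite mulVmx ?gram_unit// mulmx1.
Qed.

Lemma hat_diag t : \sum_s hat_mx t s ^+ 2 = hat_mx t t.
Proof.
rewrite -[in RHS]hat_idem mxE; apply: eq_bigr => s _.
by rewrite (hat_symE s t) -expr2.
Qed.

Lemma hat_diag_ge0 t : 0 <= hat_mx t t.
Proof. by rewrite -hat_diag sumr_ge0// => s _; exact: sqr_ge0. Qed.

Lemma hat_diag_le1 t : hat_mx t t <= 1.
Proof.
have h : hat_mx t t ^+ 2 <= hat_mx t t.
  by rewrite -[X in _ <= X]hat_diag (bigD1 t)//= lerDl sumr_ge0// => s _; exact: sqr_ge0.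
have h0 := hat_diag_ge0 t; rewrite leNgt; apply/negP => h1; nra.
Qed.

Lemma hat_diag_le t : hat_mx t t <= c2 / T%:R * enorm (x t) ^+ 2.
Proof.
have T0' : (0 : R) < T%:R by rewrite ltr0n.
have p : 0 <= c2 / T%:R * enorm (x t) ^+ 2.
  by rewrite mulr_ge0 ?sqr_ge0// divr_ge0// ltW.
rewrite -(@ler_pXn2r _ 2) ?nnegrE ?hat_diag_ge0//.
apply: le_trans (hat_entry_le t t) _.
by rewrite [X in _ <= X]exprMn [X in _ <= _ * X]expr2.
Qed.

(** Bounding the fit by the diagonal entry alone, which idempotence allows, loses
    only one factor of the radius; bounding entry by entry would lose two. *)
Lemma hat_fit_le (v : 'cV[R]_T) t :
  (hat_mx *m v) t 0 ^+ 2 <= c2 / T%:R * enorm (x t) ^+ 2 * \sum_s v s 0 ^+ 2.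
Proof.
rewrite mxE; apply: le_trans (sum_cauchy_schwarz _ _ _) _.
rewrite hat_diag ler_wpM2r ?hat_diag_le// sumr_ge0// => s _; exact: sqr_ge0.
Qed.

Lemma resid_orth (v : 'cV[R]_T) : X^T *m ((1%:M - hat_mx) *m v) = 0.
Proof.
rewrite mulmxA mulmxBr mulmx1 /hat_mx !mulmxA -/G mulmxV ?gram_unit// mul1mx.
by rewrite subrr mul0mx.
Qed.

Lemma resid_sym : (1%:M - hat_mx)^T = 1%:M - hat_mx.
Proof. by rewrite linearB /= trmx1 hat_sym. Qed.

Lemma resid_sqr (v : 'cV[R]_T) :
  inner ((1%:M - hat_mx) *m v) ((1%:M - hat_mx) *m v) = inner v ((1%:M - hat_mx) *m v).
Proof.
set P := 1%:M - hat_mx.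
have PP : P *m P = P.
  by rewrite [in LHS]/P mulmxBr mulmx1 mulmxBl mul1mx hat_idem subrr subr0.
by rewrite -[in RHS]PP -mulmxA (inner_adj P v) resid_sym.
Qed.

(** Pythagoras: the residual of any coefficient vector is the projected outcome
    plus a vector in the column space. *)
Lemma sqr_min_residual (y : 'I_T -> bool -> R) k :
  min_residual x y k ^+ 2 =
  T%:R^-1 * (\sum_t \sum_s resid_proj x t s * y t k * y s k).
Proof.
pose v : 'cV[R]_T := \col_t y t k; pose w := (1%:M - hat_mx) *m v.
have resE b : residual x y k b =
    Num.sqrt (T%:R^-1 * inner (v - X *m b) (v - X *m b)).
  congr (Num.sqrt (_ * _)); apply: eq_bigr => t _.
  by rewrite -expr2; congr (_ ^+ 2); rewrite [in RHS]mxE [X in _ = _ + X]mxE design_mulmx mxE.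
pose bh := invmx G *m X^T *m v.
have Ev : v - X *m bh = w by rewrite /w mulmxBl mul1mx /bh /hat_mx !mulmxA.
have Ti : (0 : R) <= T%:R^-1 by rewrite invr_ge0.
have -> : min_residual x y k = Num.sqrt (T%:R^-1 * inner w w).
  have lb b : Num.sqrt (T%:R^-1 * inner w w) <= residual x y k b.
    rewrite resE ler_wsqrtr// ler_wpM2l//.
    have -> : v - X *m b = w + X *m (bh - b).
      by rewrite -Ev mulmxBr addrA subrK.
    rewrite innerDr !innerDl (innerC _ w) inner_adj resid_orth innerC inner0r.
    by rewrite addr0 add0r lerDl inner_ge0.
  apply/eqP; rewrite eq_le; apply/andP; split.
    apply: ge_inf; first by exists (Num.sqrt (T%:R^-1 * inner w w)) => _ [b _ <-].
    by exists bh => //; rewrite resE Ev.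
  apply: lb_le_inf; first by exists (residual x y k 0); exists 0.
  by move=> _ [b _ <-].
rewrite sqr_sqrtr; last by rewrite mulr_ge0 ?inner_ge0.
rewrite resid_sqr; congr (_ * _); apply: eq_bigr => t _.
rewrite mxE [X in _ * X]mxE mulr_sumr; apply: eq_bigr => s _.
by rewrite resid_projE !mxE; ring.
Qed.

Lemma covariate_radius_ge t : enorm (x t) <= covariate_radius x.
Proof. by rewrite /covariate_radius; apply: le_bigmax. Qed.

Lemma covariate_radius_ge0 : 0 <= covariate_radius x.
Proof. by apply: le_trans (enorm_ge0 (x (Ordinal T0))) (covariate_radius_ge _). Qed.

(** The Gram matrix stretches by at least T / c2 and by at most T times the squared
    radius.  The ridge penalties use the radius truncated below at 1, and this
    makes the two comparable. *)
Lemma covariate_radius_lower : 1 <= c2 * covariate_radius x ^+ 2.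
Proof.
pose v : 'cV[R]_d := const_mx 1.
have v0 : 0 < inner v v.
  rewrite lt_neqAle inner_ge0 andbT eq_sym; apply/eqP => /inner_eq0.
  move=> /colP /(_ (Ordinal dim_gt0)); rewrite !mxE => /eqP; by rewrite oner_eq0.
pose r := covariate_radius x.
have r_ge0 : 0 <= r by exact: covariate_radius_ge0.
have xv u : \sum_s inner (x s) u ^+ 2 <= T%:R * r ^+ 2 * inner u u.
  have -> : T%:R * r ^+ 2 * inner u u = \sum_(s < T) r ^+ 2 * inner u u.
    by rewrite sumr_const card_ord -[RHS]mulr_natl mulrA.
  apply: ler_sum => s _; apply: le_trans (inner_cauchy_schwarz _ _) _.
  rewrite ler_wpM2r ?inner_ge0// -sqr_enorm ler_pXn2r// ?nnegrE ?enorm_ge0//.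
  exact: covariate_radius_ge.
pose w := G *m v.
have wE : inner w w = \sum_s inner (x s) w * inner (x s) v.
  rewrite {2}/w /G -mulmxA inner_adj trmxK; apply: eq_bigr => s _.
  by rewrite !design_mulmx.
have vw : inner v v <= (c2 / T%:R) ^+ 2 * inner w w := gram_stretch v.
have T0' : (0 : R) < T%:R by rewrite ltr0n.
have w0 : 0 < inner w w.
  have : 0 < (c2 / T%:R) ^+ 2 * inner w w by apply: lt_le_trans v0 vw.
  by rewrite pmulr_rgt0// exprn_gt0// divr_gt0.
have w2 : inner w w <= (T%:R * r ^+ 2) ^+ 2 * inner v v.
  rewrite -(ler_pM2l w0) -expr2 {1}wE; apply: le_trans (sum_cauchy_schwarz _ _ _) _.
  have -> : inner w w * ((T%:R * r ^+ 2) ^+ 2 * inner v v) =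
     (T%:R * r ^+ 2 * inner w w) * (T%:R * r ^+ 2 * inner v v) by ring.
  by apply: ler_pM; rewrite ?sumr_ge0// => *; exact: sqr_ge0.
have h : 1 <= (c2 * r ^+ 2) ^+ 2.
  rewrite -(ler_pM2r v0) mul1r; apply: le_trans vw _.
  have -> : (c2 * r ^+ 2) ^+ 2 * inner v v =
    (c2 / T%:R) ^+ 2 * ((T%:R * r ^+ 2) ^+ 2 * inner v v)
    by field; rewrite gt_eqF.
  by rewrite ler_wpM2l// sqr_ge0.
have r0 : 0 <= c2 * r ^+ 2 by rewrite mulr_ge0 ?sqr_ge0// ltW.
by rewrite -(@ler_pXn2r _ 2) ?nnegrE// expr1n.
Qed.

End Design.
End LeastSquares.

(** * Laws of treatment paths and martingale sums of weight noise *)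

Lemma arm_prob_itv (R : realType) k (q : R) : 0 < q < 1 -> 0 < arm_prob k q < 1.
Proof.
by move=> /andP[q0 q1]; case: k; rewrite /arm_prob ?q0// subr_gt0 q1 gtrBl q0.
Qed.

Section Law.
Variables (R : realType) (T : nat).
Local Notation path := {ffun 'I_T -> bool}.

(** Measurability with respect to the first t rounds, on the finite space of paths. *)
Definition predictable (U : Type) (t : 'I_T) (V : path -> U) : Prop :=
  forall z z' : path, (forall s : 'I_T, (s < t)%N -> z s = z' s) -> V z = V z'.

Variables (m : path -> R) (p : path -> 'I_T -> R).

Definition expect (f : path -> R) : R := \sum_z m z * f z.

(** All that the analysis uses of the distribution of a treatment path z drawn with
    predictable probabilities p z: finite sums replace integrals from here on. *)
Record assignment_law : Prop := AssignmentLaw {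
  law_ge0 : forall z, 0 <= m z;
  law_sum : \sum_z m z = 1;
  prob_itv : forall z t, 0 < p z t < 1;
  prob_predictable : forall t, predictable t (fun z => p z t);
  law_cond : forall t k V, predictable t V ->
    expect (fun z => (z t == k)%:R * V z) =
    expect (fun z => arm_prob k (p z t) * V z) }.

Hypothesis L : assignment_law.

Lemma expectD f g : expect (fun z => f z + g z) = expect f + expect g.
Proof. by rewrite -big_split; apply: eq_bigr => z _; rewrite mulrDr. Qed.

Lemma expectZ a f : expect (fun z => a * f z) = a * expect f.
Proof. by rewrite mulr_sumr; apply: eq_bigr => z _; rewrite mulrCA. Qed.

Lemma expect_cst a : expect (fun=> a) = a.
Proof. by rewrite /expect -mulr_suml (law_sum L) mul1r. Qed.

Lemma expect_sum (I : finType) (Q : pred I) (F : I -> path -> R) :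
  expect (fun z => \sum_(i | Q i) F i z) = \sum_(i | Q i) expect (F i).
Proof.
rewrite /expect exchange_big /=; apply: eq_bigr => z _.
by rewrite mulr_sumr.
Qed.

Lemma expect_le f g : (forall z, f z <= g z) -> expect f <= expect g.
Proof. by move=> h; apply: ler_sum => z _; rewrite ler_wpM2l// (law_ge0 L). Qed.

Lemma expect_ge0 f : (forall z, 0 <= f z) -> 0 <= expect f.
Proof. by move=> h; apply: sumr_ge0 => z _; rewrite mulr_ge0// (law_ge0 L). Qed.

Lemma expect_eq f g : (forall z, f z = g z) -> expect f = expect g.
Proof. by move=> h; apply: eq_bigr => z _; rewrite h. Qed.

Lemma expect_markov (f : path -> R) (a : R) : 0 < a -> (forall z, 0 <= f z) ->
  \sum_(z | a < f z) m z <= expect f / a.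
Proof.
move=> a0 f0; rewrite ler_pdivlMr// mulr_suml.
rewrite /expect [X in _ <= X](bigID (fun z => a < f z))/= -[X in X <= _]addr0.
apply: lerD.
  by apply: ler_sum => z /ltW az; rewrite ler_wpM2l// (law_ge0 L).
by apply: sumr_ge0 => z _; rewrite mulr_ge0// (law_ge0 L).
Qed.

Lemma arm_prob_gt0 k z t : 0 < arm_prob k (p z t).
Proof. by have /andP[] := arm_prob_itv k (prob_itv L z t). Qed.

Lemma arm_prob_lt1 k z t : arm_prob k (p z t) < 1.
Proof. by have /andP[] := arm_prob_itv k (prob_itv L z t). Qed.

Lemma predictableP (U : Type) k t (V : path -> U) (f : R -> U -> R) :
  predictable t V -> predictable t (fun z => f (arm_prob k (p z t)) (V z)).
Proof. by move=> hV z z' h; rewrite (hV _ _ h) (prob_predictable L h). Qed.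

Section Noise.
Variable k : bool.
Definition ipw_noise (z : path) (t : 'I_T) : R := ipw z (p z) k t - 1.

Lemma expect_ipw t V : predictable t V ->
  expect (fun z => ipw z (p z) k t * V z) = expect V.
Proof.
move=> hV.
have := law_cond L k (predictableP k (fun q v => q^-1 * v) hV).
rewrite (@expect_eq (fun z => arm_prob _ _ * _) V); last first.
  by move=> z; rewrite mulrA divff ?mul1r// gt_eqF// arm_prob_gt0.
move=> <-; apply: expect_eq => z; by rewrite /ipw mulrA.
Qed.

Lemma expect_ipw_sqr t V : predictable t V ->
  expect (fun z => ipw z (p z) k t ^+ 2 * V z) =
  expect (fun z => (arm_prob k (p z t))^-1 * V z).
Proof.
move=> hV.
rewrite -(expect_ipw (predictableP k (fun q v => q^-1 * v) hV)).
apply: expect_eq => z; rewrite /ipw; set q := (arm_prob _ _)^-1.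
by case: (_ == _); rewrite /=; ring.
Qed.

Lemma expect_noise t V : predictable t V ->
  expect (fun z => ipw_noise z t * V z) = 0.
Proof.
move=> hV; rewrite (@expect_eq _ (fun z => ipw z (p z) k t * V z + (-1) * V z)).
  by rewrite expectD expectZ expect_ipw// mulN1r subrr.
by move=> z; rewrite /ipw_noise; ring.
Qed.

Lemma expect_noise_sqr t V : predictable t V ->
  expect (fun z => ipw_noise z t ^+ 2 * V z) =
  expect (fun z => ((arm_prob k (p z t))^-1 - 1) * V z).
Proof.
move=> hV.
rewrite (@expect_eq _ (fun z => ipw z (p z) k t ^+ 2 * V z + (-2) * (ipw z (p z) k t * V z) + V z)); last first.
  by move=> z; rewrite /ipw_noise; ring.
rewrite !expectD expectZ expect_ipw_sqr// expect_ipw//.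
rewrite [RHS](@expect_eq _ (fun z => (arm_prob k (p z t))^-1 * V z + (-1) * V z)).
  by rewrite expectD expectZ; ring.
by move=> z; ring.
Qed.

Lemma noise_predictable (s t : 'I_T) : (s < t)%N -> predictable t (fun z => ipw_noise z s).
Proof.
move=> st z z' h; rewrite /ipw_noise /ipw h//.
by rewrite (@prob_predictable L s z z')// => r rs; apply: h; apply: ltn_trans st.
Qed.

Lemma predictable_leq (U : Type) (s t : 'I_T) (V : path -> U) : (s <= t)%N -> predictable s V -> predictable t V.
Proof. by move=> st hV z z' h; apply: hV => r rs; apply: h; apply: leq_trans st. Qed.

(** The summands are martingale differences, so cross terms vanish. *)
Lemma expect_martingale_sqr (V : 'I_T -> path -> R) :
  (forall t, predictable t (V t)) ->
  expect (fun z => (\sum_t ipw_noise z t * V t z) ^+ 2) =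
  \sum_t expect (fun z => ((arm_prob k (p z t))^-1 - 1) * V t z ^+ 2).
Proof.
move=> hV; pose D t z := ipw_noise z t * V t z.
have cross (s t : 'I_T) : (s < t)%N -> expect (fun z => D t z * D s z) = 0.
  move=> st; rewrite (@expect_eq _ (fun z => ipw_noise z t * (V t z * D s z))).
    apply: expect_noise => z z' h; rewrite /D (hV t _ _ h) (noise_predictable st h).
    by rewrite (predictable_leq (ltnW st) (hV s) h).
  by move=> z; rewrite /D; ring.
rewrite (@expect_eq _ (fun z => \sum_t \sum_s D t z * D s z)); last first.
  by move=> z; rewrite expr2 mulr_suml; apply: eq_bigr => t _; rewrite mulr_sumr.
rewrite expect_sum; apply: eq_bigr => t _.
rewrite expect_sum (bigD1 t)//= big1 ?addr0.
  rewrite -expect_noise_sqr; last by move=> z z' h; rewrite (hV t _ _ h).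
  by apply: expect_eq => z; rewrite /D; ring.
move=> s; rewrite -val_eqE /= neq_ltn => /orP[/cross//|/cross h].
by rewrite -{}[RHS]h; apply: expect_eq => z; rewrite mulrC.
Qed.

End Noise.
End Law.

(** * The expected prediction loss grows linearly *)

Section Radius.
Variables (R : realType) (T d : nat) (x : 'I_T -> 'cV[R]_d).

Lemma running_radius_ge1 t : 1 <= running_radius x t.
Proof. exact: bigmax_ge_id. Qed.

Lemma running_radius_ge t : enorm (x t) <= running_radius x t.
Proof. exact: le_bigmax_cond. Qed.

Lemma running_radius_mono (s t : 'I_T) : (s <= t)%N ->
  running_radius x s <= running_radius x t.
Proof.
move=> st; apply: bigmax_le; first exact: running_radius_ge1.
by move=> r rs; apply: le_bigmax_cond; apply: leq_trans st.
Qed.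

Lemma running_radius_le t : running_radius x t <= Num.max 1 (covariate_radius x).
Proof.
apply: bigmax_le; first by rewrite le_max lexx.
by move=> s _; rewrite le_max covariate_radius_ge orbT.
Qed.

Lemma inv_eta t : (eta x t)^-1 = Num.sqrt T%:R * running_radius x t.
Proof. by rewrite /eta invfM !invrK. Qed.

Lemma sqrt_horizon_gt0 (t : 'I_T) : 0 < Num.sqrt (T%:R : R).
Proof. by rewrite sqrtr_gt0 ltr0n; apply: leq_ltn_trans (ltn_ord t). Qed.

Lemma inv_eta_gt0 t : 0 < (eta x t)^-1.
Proof.
rewrite inv_eta mulr_gt0 ?(sqrt_horizon_gt0 t)//.
exact: lt_le_trans (running_radius_ge1 t).
Qed.

End Radius.

Section Experiment.
Variables (R : realType) (b1 b2 b3 : R) (phi : R -> R).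
Hypothesis b10 : 0 < b1.
Hypothesis hphi : sigmoid_condition b1 b2 b3 phi.
Variables (T d : nat) (x : 'I_T -> 'cV[R]_d) (y : 'I_T -> bool -> R).
Local Notation path := {ffun 'I_T -> bool}.
Variables (m : path -> R) (p : path -> 'I_T -> R).
Variable beta : path -> bool -> 'I_T -> 'cV[R]_d.
Hypothesis L : assignment_law m p.
Hypothesis F : forall z : path, sigmoid_ftrl phi x y z (p z) (beta z).
Local Notation Ex := (expect m).

Lemma observed_ipw (z : path) k t :
  observed y z t * ipw z (p z) k t = y t k * ipw z (p z) k t.
Proof.
by rewrite /observed /ipw; case: eqP => [->//|_]; rewrite mul0r !mulr0.
Qed.

Lemma ipw_predictable (s t : 'I_T) k : (s < t)%N -> predictable t (fun z => ipw z (p z) k s).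
Proof.
move=> st z z' h; have := noise_predictable L k st h; rewrite /ipw_noise.
exact: addIr.
Qed.

(** A ridge minimiser is unique, and its objective only involves earlier rounds. *)
Lemma beta_predictable k t : predictable t (fun z => beta z k t).
Proof.
move=> z z' h; have [[hz _] [hz' _]] := (F z t, F z' t).
apply: (@ridge_argmin_unique R _ (fun s : 'I_T => (s < t)%N) d x
  (fun s => observed y z s * ipw z (p z) k s) (eta x t)^-1) => //.
- exact: inv_eta_gt0.
- exact: (hz k).
have := hz' k; congr (is_argmin _ _ _); apply/funext => b.
congr (_ + _); apply: eq_bigr => s st; rewrite !observed_ipw.
by rewrite (ipw_predictable k st h).
Qed.

Definition pred_error (k : bool) (t : 'I_T) (z : path) : R :=
  y t k - inner (x t) (beta z k t).

Lemma pred_error_predictable k t : predictable t (pred_error k t).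
Proof. by move=> z z' h; rewrite /pred_error (beta_predictable k h). Qed.

Lemma running_lossE (z : path) k t : running_loss x y z (p z) (beta z) k t =
  \sum_(s < T | (s < t)%N) ipw z (p z) k s * pred_error k s z ^+ 2.
Proof.
apply: eq_bigr => s _; rewrite /pred_error /observed /ipw.
by case: eqP => [->//|_]; rewrite !mul0r.
Qed.

Lemma ipw_ge0 (z : path) k t : 0 <= ipw z (p z) k t.
Proof. by rewrite divr_ge0// ltW// (arm_prob_gt0 L). Qed.

Lemma running_loss_ge0 (z : path) k t : 0 <= running_loss x y z (p z) (beta z) k t.
Proof.
by rewrite running_lossE sumr_ge0// => s _; rewrite mulr_ge0 ?ipw_ge0 ?sqr_ge0.
Qed.

Definition loss_before (t : 'I_T) (z : path) : R :=
  running_loss x y z (p z) (beta z) true t + running_loss x y z (p z) (beta z) false t.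

Lemma loss_before_predictable t : predictable t (loss_before t).
Proof.
move=> z z' h; rewrite /loss_before !running_lossE; congr (_ + _);
  apply: eq_bigr => s st; rewrite (ipw_predictable _ st h);
  by rewrite (predictable_leq (ltnW st) (@pred_error_predictable _ s) h).
Qed.

(** The two running losses after the last round, which dominate all earlier ones. *)
Definition total_loss (z : path) : R :=
  \sum_s ipw z (p z) true s * pred_error true s z ^+ 2 +
  \sum_s ipw z (p z) false s * pred_error false s z ^+ 2.

Lemma loss_before_le t z : loss_before t z <= total_loss z.
Proof.
rewrite /loss_before !running_lossE; apply: lerD;
  rewrite [X in _ <= X](bigID (fun s : 'I_T => (s < t)%N))/= lerDl sumr_ge0// => s _;
  by rewrite mulr_ge0 ?ipw_ge0 ?sqr_ge0.
Qed.

Lemma total_loss_ge0 z : 0 <= total_loss z.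
Proof. by rewrite addr_ge0// sumr_ge0// => s _; rewrite mulr_ge0 ?ipw_ge0 ?sqr_ge0. Qed.

Lemma expect_total_loss : Ex total_loss =
  \sum_s Ex (fun z => pred_error true s z ^+ 2) +
  \sum_s Ex (fun z => pred_error false s z ^+ 2).
Proof.
rewrite expectD !expect_sum; congr (_ + _); apply: eq_bigr => s _;
  apply: expect_ipw => // z z' h; by rewrite (@pred_error_predictable _ _ _ _ h).
Qed.

Lemma inv_prob_bound (z : path) t : exists u, [/\ 0 <= u,
    Num.sqrt T%:R * running_radius x t * u ^+ 4 <=
      5 / sigmoid_slope phi * loss_before t z &
    forall k, (arm_prob k (p z t))^-1 <= 2 + b1 * u].
Proof.
rewrite -inv_eta; have [_ hp] := F z t.
apply: (inv_arm_prob_le hphi b10 _ _ _ hp); rewrite ?running_loss_ge0//.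
exact/ltW/inv_eta_gt0.
Qed.

(** In expectation the regret inequality loses its label noise on both sides: the
    squared labels exceed y^2, and the squared errors exceed the squared
    prediction errors, by the same variance y^2 (1 / pi - 1).  Only the fraction h
    of it remains. *)
Lemma expect_loss_le (h : R) k : 0 < h -> h <= 2^-1 ->
  (forall t, enorm (x t) ^+ 2 <= h * (eta x t)^-1) ->
  \sum_s Ex (fun z => pred_error k s z ^+ 2) <=
  \sum_s y s k ^+ 2 +
  2 * h * \sum_s y s k ^+ 2 * Ex (fun z => (arm_prob k (p z s))^-1).
Proof.
move=> h0 h2 hx.
pose v (z : path) t := y t k * ipw z (p z) k t.
have path_ineq z : (1 - h) * \sum_t (v z t - inner (x t) (beta z k t)) ^+ 2 <=
    \sum_t v z t ^+ 2.
  apply: (@ridge_regret R T d x (v z) (fun t => (eta x t)^-1) _ h) => //.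
  - by move=> t; exact: inv_eta_gt0.
  - move=> s t st; rewrite !inv_eta ler_wpM2l ?sqrtr_ge0//.
    exact: running_radius_mono.
  - move=> t; have [/(_ k) + _] := F z t; congr is_argmin.
    apply/funext => b; congr (_ + _); apply: eq_bigr => s _.
    by rewrite observed_ipw.
have Ev t : Ex (fun z => v z t ^+ 2) =
    y t k ^+ 2 * Ex (fun z => (arm_prob k (p z t))^-1).
  rewrite -expectZ (@expect_eq _ _ _ _ (fun z => ipw z (p z) k t ^+ 2 * y t k ^+ 2)).
    rewrite (expect_ipw_sqr L k (V := fun=> y t k ^+ 2))//.
    by apply: expect_eq => z; rewrite mulrC.
  by move=> z; rewrite /v exprMn mulrC.
have Er t : Ex (fun z => (v z t - inner (x t) (beta z k t)) ^+ 2) =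
    Ex (fun z => pred_error k t z ^+ 2) +
    (y t k ^+ 2 * Ex (fun z => (arm_prob k (p z t))^-1) - y t k ^+ 2).
  rewrite (@expect_eq _ _ _ _ (fun z => pred_error k t z ^+ 2 +
     (2 * y t k * (ipw_noise p k z t * pred_error k t z) +
      ipw_noise p k z t ^+ 2 * y t k ^+ 2))); last first.
    by move=> z; rewrite /v /pred_error /ipw_noise; ring.
  rewrite expectD; congr (_ + _); rewrite expectD expectZ.
  rewrite (expect_noise L)//; last exact: pred_error_predictable.
  rewrite (expect_noise_sqr L k (V := fun=> y t k ^+ 2))// mulr0 add0r.
  rewrite (@expect_eq _ _ _ _ (fun z => y t k ^+ 2 * (arm_prob k (p z t))^-1
     + - y t k ^+ 2)); last by move=> z; ring.
  by rewrite expectD expectZ (expect_cst L).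
have := expect_le L path_ineq.
rewrite expectZ !expect_sum.
under [X in _ <= X]eq_bigr do rewrite Ev.
under [X in _ * X <= _]eq_bigr do rewrite Er.
rewrite !big_split /= sumrN.
have : 0 <= \sum_s y s k ^+ 2 * Ex (fun z => (arm_prob k (p z s))^-1).
  apply: sumr_ge0 => s _; rewrite mulr_ge0 ?sqr_ge0//; apply: (expect_ge0 L) => z.
  by rewrite invr_ge0 ltW// (arm_prob_gt0 L).
have : 0 <= \sum_s y s k ^+ 2 by apply: sumr_ge0 => s _; exact: sqr_ge0.
have : 0 <= \sum_s Ex (fun z => pred_error k s z ^+ 2).
  by apply: sumr_ge0 => s _; apply: (expect_ge0 L) => z; exact: sqr_ge0.
set S := \sum_s Ex _; set Y := \sum_s y s k ^+ 2; set V := \sum_s _ * _.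
move=> S0 Y0 V0 hh.
have h3 : (1 - h) * S <= (1 - h) * Y + h * V by lra.
have h4 : h * V <= (1 - h) * (2 * h * V).
  have hV : 0 <= h * V by rewrite mulr_ge0// ltW.
  have -> : (1 - h) * (2 * h * V) = 2 * (1 - h) * (h * V) by ring.
  by rewrite ler_peMl//; lra.
rewrite -(@ler_pM2l _ (1 - h)); last by lra.
by rewrite mulrDr; lra.
Qed.

(** The free level a replaces the fourth root of the loss by a linear bound,
    u <= a + u ^ 4 / a ^ 3. *)
Lemma expect_inv_prob_le k t (a : R) : 0 < a ->
  Ex (fun z => (arm_prob k (p z t))^-1) <=
  2 + b1 * a + b1 * (5 / sigmoid_slope phi) / (a ^+ 3 * Num.sqrt T%:R) * Ex total_loss.
Proof.
move=> a0; rewrite -expectZ -[X in X + _](expect_cst L) -expectD.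
have sT := sqrt_horizon_gt0 R t.
have kap := sigmoid_slope_gt0 hphi.
apply: (expect_le L) => z; have [u [u0 hu hk]] := inv_prob_bound z t.
apply: le_trans (hk k) _.
have h1 : Num.sqrt T%:R * u ^+ 4 <= 5 / sigmoid_slope phi * total_loss z.
  apply: (@le_trans _ _ (5 / sigmoid_slope phi * loss_before t z)); last first.
    by rewrite ler_wpM2l ?loss_before_le// divr_ge0// ltW.
  apply: le_trans hu; rewrite -mulrA ler_wpM2l ?sqrtr_ge0//.
  rewrite ler_peMl ?running_radius_ge1//; exact: exprn_ge0.
have a3 : 0 < a ^+ 3 by rewrite exprn_gt0.
have h2 : u <= a + u ^+ 4 / a ^+ 3.
  have [ua|au] := leP u a; first by rewrite ler_wpDr// divr_ge0 ?exprn_ge0// ltW.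
  apply: (@le_trans _ _ (u ^+ 4 / a ^+ 3)); last by rewrite lerDr ltW.
  rewrite ler_pdivlMr// (exprS u 3) ler_wpM2l//.
  by rewrite ler_pXn2r// ?nnegrE ltW.
rewrite -[X in _ <= X]addrA lerD2l.
have -> : b1 * (5 / sigmoid_slope phi) / (a ^+ 3 * Num.sqrt T%:R) * total_loss z =
   b1 * ((5 / sigmoid_slope phi * total_loss z) / Num.sqrt T%:R / a ^+ 3).
  by field; rewrite !gt_eqF.
rewrite -mulrDr ler_wpM2l// ?(ltW b10)//; apply: le_trans h2 _.
by rewrite lerD2l ler_wpM2r ?invr_ge0 ?(ltW a3)// ler_pdivlMr// mulrC.
Qed.

(** A self-bounding inequality: the loss reappears on the right, because large losses
    allow small probabilities, but carries the small factor h. *)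
Lemma expect_total_loss_le (h a Y : R) : 0 < h -> h <= 2^-1 -> 0 < a ->
  (forall t, enorm (x t) ^+ 2 <= h * (eta x t)^-1) ->
  (forall k, \sum_s y s k ^+ 2 <= Y) ->
  Ex total_loss <= 2 * Y + 4 * h * Y * (2 + b1 * a +
    b1 * (5 / sigmoid_slope phi) / (a ^+ 3 * Num.sqrt T%:R) * Ex total_loss).
Proof.
move=> h0 h2 a0 hx hY; set e := 2 + _ + _.
have e0 : 0 <= e.
  rewrite /e !addr_ge0 ?mulr_ge0 ?(ltW b10) ?(ltW a0) ?invr_ge0//.
  - by rewrite (ltW (sigmoid_slope_gt0 hphi)).
  - by rewrite mulr_ge0 ?sqrtr_ge0 ?exprn_ge0// ltW.
  - exact: (expect_ge0 L total_loss_ge0).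
have one k : \sum_s Ex (fun z => pred_error k s z ^+ 2) <= Y + 2 * h * (Y * e).
  apply: le_trans (expect_loss_le k h0 h2 hx) _.
  apply: lerD => //; rewrite ler_wpM2l//; first by lra.
  apply: (@le_trans _ _ (\sum_s y s k ^+ 2 * e)).
    by apply: ler_sum => s _; rewrite ler_wpM2l ?sqr_ge0// expect_inv_prob_le.
  by rewrite -mulr_suml ler_wpM2r.
rewrite {1}expect_total_loss; have := one true; have := one false.
set u := \sum_s _; set v := \sum_s _; move=> h3 h4.
have -> : 4 * h * Y * e = 2 * (2 * h * (Y * e)) by ring.
lra.
Qed.

End Experiment.

(** * The stopped error of the residual estimator *)

Section QuadraticForm.
Variables (R : realType) (T : nat).

Lemma sum_symmetric (C : 'I_T -> 'I_T -> R) : (forall s t, C s t = C t s) ->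
  \sum_(t < T) \sum_s C t s = \sum_t C t t + 2 * \sum_(t < T) \sum_(s < T | (s < t)%N) C t s.
Proof.
move=> Cs.
have split_row (t : 'I_T) : \sum_s C t s = C t t + (\sum_(s < T | (s < t)%N) C t s +
    \sum_(s < T | (t < s)%N) C t s).
  rewrite (bigD1 t)//=; congr (_ + _).
  rewrite (bigID (fun s : 'I_T => (s < t)%N))/=; congr (_ + _); apply: eq_bigl => s;
    by rewrite -val_eqE /=; case: ltngtP.
rewrite (eq_bigr _ (fun t _ => split_row t)) !big_split /= mulr_natl mulr2n.
congr (_ + (_ + _)); rewrite [LHS](exchange_big_dep xpredT)//=.
by apply: eq_bigr => t _; apply: eq_bigr => s _.
Qed.

(** With q = 1 + e, the products q t * q s split into 1, the two linear terms,
    which agree by symmetry, and e t * e s, which is summed over s < t twice.  The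
    diagonal, weighted once by q, contributes - B t t e t. *)
Lemma quadratic_form_noise (B : 'I_T -> 'I_T -> R) (q : 'I_T -> R) :
  (forall s t, B s t = B t s) ->
  \sum_t B t t * q t + \sum_t \sum_(s < T | s != t) B t s * (q t * q s)
    - \sum_t \sum_s B t s =
  \sum_(t < T) (q t - 1) * (2 * (\sum_s B t s) - B t t
    + 2 * \sum_(s < T | (s < t)%N) B t s * (q s - 1)).
Proof.
move=> Bs; pose e t := q t - 1.
have h1 : \sum_t \sum_(s < T | s != t) B t s * (q t * q s) =
    \sum_t \sum_s B t s * (q t * q s) - \sum_t B t t * q t ^+ 2.
  rewrite -sumrB; apply: eq_bigr => t _; rewrite [in RHS](bigD1 t)//=; ring.
have h2 : \sum_t \sum_s B t s * (q t * q s) = \sum_t \sum_s B t s +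
    (\sum_t \sum_s B t s * e t + \sum_t \sum_s B t s * e s
     + \sum_t \sum_s B t s * (e t * e s)).
  rewrite -!big_split; apply: eq_bigr => t _; rewrite -!big_split.
  by apply: eq_bigr => s _; rewrite /= /e; ring.
have h3 : \sum_t \sum_s B t s * e s = \sum_t \sum_s B t s * e t.
  rewrite exchange_big; apply: eq_bigr => t _; apply: eq_bigr => s _.
  by rewrite Bs.
have h4 := @sum_symmetric (fun t s => B t s * (e t * e s)).
rewrite h1 h2 h3 {}h4 => [|s t]; last by rewrite Bs (mulrC (e s)).
have -> : \sum_(t < T) (q t - 1) * (2 * (\sum_s B t s) - B t t
    + 2 * \sum_(s < T | (s < t)%N) B t s * (q s - 1)) =
    2 * (\sum_t \sum_s B t s * e t) +
    2 * (\sum_(t < T) \sum_(s < T | (s < t)%N) B t s * (e t * e s))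
    - \sum_t B t t * e t.
  rewrite !mulr_sumr -big_split -sumrB; apply: eq_bigr => t _ /=.
  rewrite -!mulr_suml -/(e t).
  have -> : \sum_(s < T | (s < t)%N) B t s * (e t * e s) =
      e t * \sum_(s < T | (s < t)%N) B t s * (q s - 1).
    by rewrite mulr_sumr; apply: eq_bigr => s _; rewrite -/(e s); ring.
  by ring.
have -> : \sum_t B t t * e t = \sum_t B t t * q t ^+ 2 - \sum_t B t t * q t -
   \sum_t B t t * e t ^+ 2.
  2: ring.
rewrite -!sumrB; apply: eq_bigr => t _; rewrite /e; ring.
Qed.

End QuadraticForm.

Section Truncation.
Variables (R : realType) (b1 b2 b3 : R) (phi : R -> R).
Hypothesis b10 : 0 < b1.
Hypothesis hphi : sigmoid_condition b1 b2 b3 phi.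
Variables (T d : nat) (x : 'I_T -> 'cV[R]_d) (y : 'I_T -> bool -> R).
Local Notation path := {ffun 'I_T -> bool}.
Variables (m : path -> R) (p : path -> 'I_T -> R).
Variable beta : path -> bool -> 'I_T -> 'cV[R]_d.
Hypothesis L : assignment_law m p.
Hypothesis F : forall z : path, sigmoid_ftrl phi x y z (p z) (beta z).
Local Notation Ex := (expect m).
Variable c2 : R.
Hypothesis T0 : (0 < T)%N.
Hypothesis c20 : 0 < c2.
Hypothesis hs : c2^-1 <= sigma_min (T%:R^-1 *: \sum_(s < T) (x s *m (x s)^T)).
Variables (K V Y2 Y4 : R) (k : bool).
Hypothesis V0 : 0 <= V.
Hypothesis hV : forall (z : path) t, loss_before x y p beta t z <= K ->
  (arm_prob k (p z t))^-1 * running_radius x t ^+ 2 <= V.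
Hypothesis hY2 : \sum_t y t k ^+ 2 <= Y2.
Hypothesis hY4 : \sum_t y t k ^+ 4 <= Y4.

(** It is known before round t, and while it is 1 the inverse probability of round t
    has a deterministic bound; without it, that inverse probability and the earlier
    noise would have to be decoupled. *)
Definition active (t : 'I_T) (z : path) : R := (loss_before x y p beta t z <= K)%R%:R.

Lemma active_predictable t : predictable t (active t).
Proof. by move=> z z' h; rewrite /active (loss_before_predictable L F h). Qed.

Let B (t s : 'I_T) : R := resid_proj x t s * y t k * y s k.

Let lin (t : 'I_T) : R := 2 * (\sum_s B t s) - B t t.

Let cross (t : 'I_T) (z : path) : R :=
  \sum_s ipw_noise p k z s * ((s < t)%N%:R * B t s * active s z).

Definition stopped_error (z : path) : R :=
  \sum_t ipw_noise p k z t * (active t z * (lin t + 2 * cross t z)).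

Lemma hatA_error (z : path) : (forall t, loss_before x y p beta t z <= K) ->
  T%:R * (hatA x y z (p z) k - min_residual x y k ^+ 2) = stopped_error z.
Proof.
move=> hz; have T0' : T%:R != 0 :> R by rewrite pnatr_eq0 -lt0n.
rewrite (sqr_min_residual T0 c20 hs) /hatA -mulrDr -mulrBr mulrA divff// mul1r.
have Bs s t : B s t = B t s.
  by rewrite /B !resid_entry eq_sym (hat_symE x); ring.
have := quadratic_form_noise (ipw z (p z) k) Bs.
have -> : \sum_t B t t * ipw z (p z) k t =
   \sum_t resid_proj x t t * observed y z t ^+ 2 * ipw z (p z) k t.
  apply: eq_bigr => t _; rewrite /B.
  have -> : resid_proj x t t * y t k * y t k * ipw z (p z) k t =
    resid_proj x t t * y t k * (y t k * ipw z (p z) k t) by ring.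
  rewrite -observed_ipw.
  have -> : resid_proj x t t * y t k * (observed y z t * ipw z (p z) k t) =
    resid_proj x t t * observed y z t * (y t k * ipw z (p z) k t) by ring.
  rewrite -observed_ipw; ring.
have -> : \sum_t \sum_(s < T | s != t) B t s * (ipw z (p z) k t * ipw z (p z) k s) =
   \sum_t \sum_(s < T | s != t) resid_proj x t s * observed y z t * observed y z s
       * (ipw z (p z) k t * ipw z (p z) k s).
  apply: eq_bigr => t _; apply: eq_bigr => s _; rewrite /B.
  have -> : resid_proj x t s * y t k * y s k * (ipw z (p z) k t * ipw z (p z) k s) =
    resid_proj x t s * (y t k * ipw z (p z) k t) * (y s k * ipw z (p z) k s) by ring.
  rewrite -!observed_ipw; ring.
move=> ->; apply: eq_bigr => t _; congr (_ * _).
rewrite /active hz mul1r; congr (_ + _ * _); rewrite /cross [in RHS](bigID (fun s : 'I_T => (s < t)%N)) /=.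
rewrite [X in _ = _ + X]big1 ?addr0 => [|s /negbTE->]; last by rewrite !mul0r mulr0.
apply: eq_bigr => s ->; rewrite /active hz mul1r mulr1 mulrC; congr (_ * _).
Qed.

Lemma active_noise_le t (W : path -> R) : (forall z, 0 <= W z) ->
  Ex (fun z => ((arm_prob k (p z t))^-1 - 1) * (active t z ^+ 2 * W z)) <=
  V / running_radius x t ^+ 2 * Ex W.
Proof.
move=> W0; rewrite -expectZ; apply: (expect_le L) => z.
have r0 : 0 < running_radius x t ^+ 2.
  by rewrite exprn_gt0// (lt_le_trans _ (running_radius_ge1 _ _)).
have Vr : 0 <= V / running_radius x t ^+ 2 by rewrite divr_ge0// ltW.
rewrite /active; case: (leP _ K) => hz; last by rewrite expr0n /= mul0r mulr0 mulr_ge0.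
rewrite expr1n mul1r ler_wpM2r// ler_pdivlMr//.
apply: le_trans (hV hz); rewrite ler_wpM2r ?(ltW r0)//; lra.
Qed.

(** The weight V / running_radius^2 of each noise term cancels the squared radius in
    the bound on the squared entries of the hat matrix. *)
Lemma expect_cross_sqr t : Ex (fun z => cross t z ^+ 2) <=
  (c2 / T%:R) ^+ 2 * running_radius x t ^+ 2 * y t k ^+ 2 * V * Y2.
Proof.
rewrite (expect_martingale_sqr L k (V := fun s z => (s < t)%N%:R * B t s * active s z)); last first.
  by move=> s z z' h; rewrite (active_predictable h).
have c0 : 0 <= (c2 / T%:R) ^+ 2 * running_radius x t ^+ 2 * y t k ^+ 2 * V.
  by rewrite mulr_ge0// mulr_ge0 ?sqr_ge0// mulr_ge0 ?sqr_ge0.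
apply: le_trans (ler_wpM2l c0 hY2); rewrite mulr_sumr; apply: ler_sum => s _.
rewrite (@expect_eq _ _ _ _ (fun z => ((arm_prob k (p z s))^-1 - 1) *
   (active s z ^+ 2 * (((s < t)%N%:R * B t s) ^+ 2)))); last first.
  by move=> z; rewrite exprMn mulrC [in LHS](mulrC _ (active s z ^+ 2)) mulrC.
apply: le_trans (active_noise_le s (fun _ => sqr_ge0 _)) _.
rewrite (expect_cst L).
have r0 u : 0 < running_radius x u.
  by rewrite (lt_le_trans _ (running_radius_ge1 _ _)).
have r20 u : 0 < running_radius x u ^+ 2 by rewrite exprn_gt0.
rewrite mulrAC ler_pdivrMr//.
case: (ltnP s t) => st; last first.
  rewrite mul0r expr0n mulr0; apply: mulr_ge0; last exact: sqr_ge0.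
  by apply: mulr_ge0 => //; exact: sqr_ge0.
have hB : B t s ^+ 2 <= (c2 / T%:R) ^+ 2 *
    (running_radius x t ^+ 2 * running_radius x s ^+ 2) * (y t k ^+ 2 * y s k ^+ 2).
  have -> : B t s ^+ 2 = hat_mx x t s ^+ 2 * (y t k ^+ 2 * y s k ^+ 2).
    rewrite /B !resid_entry -val_eqE /= gtn_eqF//=; ring.
  rewrite ler_wpM2r//; first by apply: mulr_ge0; exact: sqr_ge0.
  apply: le_trans (hat_entry_le T0 c20 hs s t) _.
  rewrite ler_wpM2l ?sqr_ge0//; apply: ler_pM; rewrite ?sqr_ge0//;
    by rewrite ler_pXn2r// ?nnegrE ?enorm_ge0 ?(ltW (r0 _)) ?running_radius_ge.
rewrite /= mul1r; apply: le_trans (ler_wpM2l V0 hB) _.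
by rewrite le_eqVlt; apply/orP; left; apply/eqP; ring.
Qed.

Lemma lin_sqr_le t : lin t ^+ 2 <= y t k ^+ 2 *
  (8 * y t k ^+ 2 + 8 * (c2 / T%:R) * running_radius x t ^+ 2 * Y2).
Proof.
pose v : 'cV[R]_T := \col_s y s k; pose f := (hat_mx x *m v) t 0.
have linE : lin t = y t k * (y t k * (1 + hat_mx x t t) - 2 * f).
  rewrite /lin.
  have -> : \sum_s B t s = y t k * (y t k - f).
    have -> : y t k - f = ((1%:M - hat_mx x) *m v) t 0.
      by rewrite mulmxBl mul1mx mxE [X in _ = _ + X]mxE mxE.
    rewrite mxE mulr_sumr; apply: eq_bigr => s _.
    rewrite /B resid_projE [v _ _]mxE; ring.
  by rewrite /B !resid_entry eqxx /=; ring.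
rewrite linE exprMn ler_wpM2l ?sqr_ge0//.
have H0 := hat_diag_ge0 T0 c20 hs t; have H1 := hat_diag_le1 T0 c20 hs t.
have f2 : f ^+ 2 <= c2 / T%:R * running_radius x t ^+ 2 * Y2.
  apply: le_trans (hat_fit_le T0 c20 hs v t) _.
  have -> : \sum_s v s 0 ^+ 2 = \sum_t y t k ^+ 2 by apply: eq_bigr => s _; rewrite mxE.
  apply: ler_pM => //.
  - by rewrite mulr_ge0 ?sqr_ge0// divr_ge0// ltW.
  - by rewrite sumr_ge0// => s _; exact: sqr_ge0.
  rewrite ler_wpM2l//; first by rewrite divr_ge0// ltW.
  rewrite ler_pXn2r// ?nnegrE ?enorm_ge0 ?running_radius_ge//.
  by rewrite (le_trans _ (running_radius_ge1 _ _)).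
set a := y t k in f2 *; set H := hat_mx x t t in H0 H1 *.
have : (a * (1 + H) - 2 * f) ^+ 2 <= 2 * (a ^+ 2 * (1 + H) ^+ 2) + 8 * f ^+ 2.
  have := sqr_ge0 (a * (1 + H) + 2 * f); lra.
have : a ^+ 2 * (1 + H) ^+ 2 <= a ^+ 2 * 4.
  by rewrite ler_wpM2l ?sqr_ge0//; nra.
lra.
Qed.

Lemma cross_predictable t : predictable t (cross t).
Proof.
move=> z z' h; apply: eq_bigr => s _; case: (ltnP s t) => st; last by rewrite !mul0r !mulr0.
by rewrite (noise_predictable L k st h) (predictable_leq (ltnW st) (@active_predictable s) h).
Qed.

(** The squares of both parts of the coefficient of noise t are of the order of the
    squared running radius, so V enters with the radius cancelled. *)
Lemma expect_stopped_error_sqr : Ex (fun z => stopped_error z ^+ 2) <=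
  V * (16 * Y4 + 16 * (c2 / T%:R) * Y2 ^+ 2 + 8 * (c2 / T%:R) ^+ 2 * V * Y2 ^+ 2).
Proof.
rewrite (expect_martingale_sqr L k (V := fun t z => active t z * (lin t + 2 * cross t z))); last first.
  by move=> t z z' h; rewrite (active_predictable h) (cross_predictable h).
have cT : 0 <= c2 / T%:R by rewrite divr_ge0// ltW.
have Y20 : 0 <= Y2 by apply: le_trans hY2; rewrite sumr_ge0// => s _; exact: sqr_ge0.
pose e := 16 * (c2 / T%:R) * Y2 + 8 * (c2 / T%:R) ^+ 2 * V * Y2.
have e0 : 0 <= e.
  apply: addr_ge0; first by apply: mulr_ge0 => //; apply: mulr_ge0.
  apply: mulr_ge0 => //; apply: mulr_ge0 => //; apply: mulr_ge0 => //.
  exact: sqr_ge0.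
apply: (@le_trans _ _ (\sum_t V * (16 * y t k ^+ 4 + e * y t k ^+ 2))); last first.
  rewrite -mulr_sumr ler_wpM2l// big_split /= -!mulr_sumr -[X in _ <= X]addrA.
  apply: lerD; first by rewrite ler_wpM2l.
  apply: le_trans (ler_wpM2l e0 hY2) _; rewrite /e.
  by rewrite le_eqVlt; apply/orP; left; apply/eqP; ring.
apply: ler_sum => t _.
apply: (@le_trans _ _ (Ex (fun z => ((arm_prob k (p z t))^-1 - 1) *
   (active t z ^+ 2 * (2 * lin t ^+ 2 + 8 * cross t z ^+ 2))))).
  apply: (expect_le L) => z; rewrite ler_wpM2l//.
    rewrite subr_ge0 invf_ge1 ?(arm_prob_gt0 L)//; exact/ltW/(arm_prob_lt1 L).
  rewrite exprMn ler_wpM2l ?sqr_ge0//.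
  have := sqr_ge0 (lin t - 2 * cross t z); lra.
apply: le_trans (active_noise_le t _) _.
  by move=> z; rewrite addr_ge0// mulr_ge0// sqr_ge0.
rewrite expectD (expect_cst L) expectZ.
set r := running_radius x t.
have r1 : 1 <= r by exact: running_radius_ge1.
have r20 : 1 <= r ^+ 2 by rewrite expr_ge1// (le_trans _ r1).
have r2p : 0 < r ^+ 2 by lra.
rewrite -mulrA ler_wpM2l// mulrC ler_pdivrMr//.
have h1 := lin_sqr_le t; have h2 := expect_cross_sqr t; rewrite -/r in h1 h2.
apply: (@le_trans _ _ (2 * (y t k ^+ 2 *
  (8 * y t k ^+ 2 + 8 * (c2 / T%:R) * r ^+ 2 * Y2)) + 8 *
  ((c2 / T%:R) ^+ 2 * r ^+ 2 * y t k ^+ 2 * V * Y2))).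
  by apply: lerD; rewrite ler_wpM2l.
have -> : 2 * (y t k ^+ 2 * (8 * y t k ^+ 2 + 8 * (c2 / T%:R) * r ^+ 2 * Y2)) +
  8 * ((c2 / T%:R) ^+ 2 * r ^+ 2 * y t k ^+ 2 * V * Y2) =
  16 * y t k ^+ 4 + e * y t k ^+ 2 * r ^+ 2 by rewrite /e; ring.
rewrite [X in _ <= X]mulrDl lerD2r ler_peMr//.
by rewrite mulr_ge0// (exprM _ 2 2) sqr_ge0.
Qed.

End Truncation.

(** * From the probability space to a law on treatment paths *)

Section DesignLaw.
Variables (R : realType) (disp : measure_display) (Omega : measurableType disp).
Variables (P : probability Omega R) (T : nat) (Z : 'I_T -> Omega -> bool).
Variable p : 'I_T -> Omega -> R.
Hypothesis mZ : forall t, measurable_fun [set: Omega] (Z t).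
Hypothesis cp : forall t, is_cond_prob P (past_sigma Z t) [set w | Z t w] (p t).
Hypothesis p01 : forall t w, 0 < p t w < 1.
Local Notation path := {ffun 'I_T -> bool}.

Definition cylinder (n : nat) (a : path) : set Omega :=
  [set w | forall s : 'I_T, (s < n)%N -> Z s w = a s].

Definition realised (w : Omega) : path := [ffun t => Z t w].

(** The sets that do not distinguish outcomes with the same past form a
    sigma-algebra that contains the generators. *)
Lemma past_sigma_invariant (t : 'I_T) (C : set Omega) : past_sigma Z t C ->
  forall w w', (forall s : 'I_T, (s < t)%N -> Z s w = Z s w') -> C w -> C w'.
Proof.
pose Inv := [set C : set Omega | forall w w',
  (forall s : 'I_T, (s < t)%N -> Z s w = Z s w') -> C w <-> C w'].
move=> hC; suff : Inv C by move=> h w w' /h[].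
move: C hC; apply: smallest_sub.
  split=> //.
    by move=> A hA w w' h; rewrite /setD /= (hA _ _ h).
  move=> A hA w w' h; split=> -[n _ An]; exists n => //; first by apply/(hA n _ _ h).
  by apply/(hA n _ _ h).
move=> C [s st [B _ <-]] w w' h /=.
by rewrite /setI /= (h s st).
Qed.

Lemma prob_past (t : 'I_T) w w' : (forall s : 'I_T, (s < t)%N -> Z s w = Z s w') -> p t w = p t w'.
Proof.
move=> h; have [hp _] := cp t.
have A : past_sigma Z t ([set: Omega] `&` p t @^-1` [set p t w]).
  by apply: hp; exists [set p t w].
by have [_ /= ->] := past_sigma_invariant A h (conj Logic.I erefl).
Qed.

Lemma cylinder_bigcap n a :
  cylinder n a = \bigcap_(s in [set s : 'I_T | (s < n)%N]) (Z s @^-1` [set a s]).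
Proof. by apply/seteqP; split => w. Qed.

Lemma past_cylinder (t : 'I_T) a : past_sigma Z t (cylinder t a).
Proof.
rewrite cylinder_bigcap.
apply: (@fin_bigcap_measurable _ (g_sigma_algebraType
  (\bigcup_(s in [set s : 'I_T | (s < t)%N])
        preimage_set_system [set: Omega] (Z s) measurable))).
  exact: finite_finset.
move=> s st; apply: sub_gen_smallest; exists s => //.
by exists [set a s] => //; rewrite setTI.
Qed.

Lemma measurable_cylinder n a : measurable (cylinder n a).
Proof.
rewrite cylinder_bigcap; apply: fin_bigcap_measurable; first exact: finite_finset.
by move=> s _; rewrite -[X in measurable X]setTI; apply: mZ.
Qed.

Lemma measurable_arm t k : measurable [set w | Z t w = k].
Proof.
rewrite (_ : [set w | Z t w = k] = [set: Omega] `&` Z t @^-1` [set k]); first exact: mZ.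
by rewrite setTI.
Qed.

(** The conditional probability is constant on a cylinder, so its integral is a
    product; the control arm follows by complement. *)
Lemma cond_arm_prob (t : 'I_T) a k w0 : cylinder t a w0 ->
  P ([set w | Z t w = k] `&` cylinder t a) = ((arm_prob k (p t w0))%:E * P (cylinder t a))%E.
Proof.
move=> hw0; have [_ hp] := cp t.
have Ptrue : P ([set w | Z t w] `&` cylinder t a) = ((p t w0)%:E * P (cylinder t a))%E.
  rewrite (hp _ (@past_cylinder t a)) -(integral_cst P (measurable_cylinder t a)).
  apply: eq_integral => w; rewrite inE => hw /=; congr EFin.
  by apply: prob_past => s st; rewrite hw// hw0.
case: k => //.
have fin_c : P (cylinder t a) \is a fin_num.
  by apply: fin_num_measure; exact: measurable_cylinder.
have fin_1 : P ([set w | Z t w] `&` cylinder t a) \is a fin_num.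
  apply: fin_num_measure; apply: measurableI; last exact: measurable_cylinder.
  exact: (measurable_arm t true).
have h : (P (cylinder t a) = P ([set w | Z t w] `&` cylinder t a) +
   P ([set w | Z t w = false] `&` cylinder t a))%E.
  rewrite -measureU.
  - congr (P _); apply/seteqP; split => w /=; last by case=> -[].
    by move=> hw; case e : (Z t w); [left|right].
  - by apply: measurableI; [exact: (measurable_arm t true)|exact: measurable_cylinder].
  - by apply: measurableI; [exact: measurable_arm|exact: measurable_cylinder].
  - by apply/seteqP; split => w //= -[[-> _] []].
rewrite /arm_prob EFinB muleBl// mul1e -Ptrue.
by rewrite [in RHS]h addeAC subee// add0e.
Qed.

(** Each round multiplies the mass of a cylinder by a probability in ]0, 1[. *)
Lemma cylinder_gt0 n a : (n <= T)%N -> (0 < P (cylinder n a))%E.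
Proof.
elim: n => [|n IH] nT.
  rewrite (_ : cylinder 0 a = [set: Omega]); last by apply/seteqP; split => w.
  by rewrite probability_setT lte01.
pose t := Ordinal nT; have := IH (ltnW nT) => Pn.
have [w0 hw0] : cylinder n a !=set0.
  apply/set0P/negP => /eqP e; by rewrite e measure0 ltxx in Pn.
have -> : cylinder n.+1 a = [set w | Z t w = a t] `&` cylinder t a.
  apply/seteqP; split => w.
    by move=> h; split; [exact: h|move=> s st; apply: h; apply: ltnW].
  move=> [/= h1 h2] s; rewrite ltnS leq_eqVlt => /orP[/eqP e|]; last exact: h2.
  by rewrite (_ : s = t) //; apply: val_inj.
rewrite (@cond_arm_prob _ _ _ w0)//.
by apply: mule_gt0 => //; rewrite lte_fin; have /andP[] := arm_prob_itv (a t) (p01 t w0).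
Qed.

Lemma cylinder_full w a : cylinder T a w <-> realised w = a.
Proof.
split=> [h|<- s _]; last by rewrite ffunE.
by apply/ffunP => s; rewrite ffunE h.
Qed.

Lemma all_realised (z : path) : exists w, realised w = z.
Proof.
have : (0 < P (cylinder T z))%E by exact: cylinder_gt0.
move=> Pz; have [w hw] : cylinder T z !=set0.
  apply/set0P/negP => /eqP e; by rewrite e measure0 ltxx in Pz.
by exists w; apply/cylinder_full.
Qed.

(** Every path has positive probability, so it is realised somewhere; evaluating p and
    beta at such a point makes them functions of the path. *)
Definition witness (z : path) : Omega := projT1 (cid (all_realised z)).

Lemma witnessK z : realised (witness z) = z.
Proof. by rewrite /witness; case: cid. Qed.

Lemma witness_arm z t : Z t (witness z) = z t.
Proof. by rewrite -[in RHS](witnessK z) ffunE. Qed.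

Definition mass (z : path) : R := fine (P (cylinder T z)).

Lemma mass_event (Q : pred path) :
  P [set w | Q (realised w)] = (\sum_(z | Q z) mass z)%:E.
Proof.
have main (r : seq path) : uniq r ->
    measurable [set w | realised w \in r] /\
    P [set w | realised w \in r] = (\sum_(z <- r) mass z)%:E.
  elim: r => [_|z r IH /= /andP[zr /IH[mr Pr]]].
    rewrite (_ : [set w | _] = set0); last by apply/seteqP; split => w.
    by rewrite measure0 big_nil.
  have -> : [set w | realised w \in z :: r] = cylinder T z `|` [set w | realised w \in r].
    apply/seteqP; split => w /=; rewrite inE.
      by case/orP => [/eqP/cylinder_full|]; [left|right].
    by case=> [/cylinder_full->|->]; rewrite ?eqxx ?orbT.
  have mz := measurable_cylinder T z.
  split; first exact: measurableU.
  rewrite measureU// ?big_cons ?Pr.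
    rewrite EFinD {1}/mass fineK; first by congr (_ + _)%E; exact: Pr.
    exact: fin_num_measure.
  apply/seteqP; split => w //= -[/cylinder_full -> zr'].
  by rewrite zr' in zr.
have [_] := main [seq z <- index_enum path | Q z] (filter_uniq _ (index_enum_uniq _)).
rewrite big_filter => <-; congr (P _); apply/seteqP; split => w /=;
  by rewrite mem_filter mem_index_enum andbT.
Qed.

Lemma fine_mass_event (Q : pred path) :
  \sum_(z | Q z) mass z = fine (P [set w | Q (realised w)]).
Proof. by rewrite mass_event. Qed.

(** Grouping paths by their past up to round t, with the other rounds reset to
    control, reduces the last property to [cond_arm_prob] on each cylinder. *)
Lemma mass_law : assignment_law mass (fun z t => p t (witness z)).
Proof.
have pred_p (t : 'I_T) : predictable t (fun z => p t (witness z)).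
  by move=> z z' h; apply: prob_past => s st; rewrite !witness_arm h.
split => //.
- by move=> z; rewrite /mass fine_ge0.
- rewrite (fine_mass_event xpredT) (_ : [set w | _] = [set: Omega]).
    by rewrite probability_setT.
  by apply/seteqP; split.
move=> t k V hV; pose pre (z : path) : path := [ffun s : 'I_T => (s < t)%N && z s].
have preE z (s : 'I_T) : (s < t)%N -> pre z s = z s by move=> st; rewrite ffunE st.
rewrite /expect (partition_big pre xpredT)//= [in RHS](partition_big pre xpredT)//=.
apply: eq_bigr => a _.
have Va z : pre z == a -> V z = V a.
  by move=> /eqP <-; apply: hV => s st; rewrite preE.
have pa z : pre z == a -> p t (witness z) = p t (witness a).
  by move=> /eqP <-; apply: pred_p => s st; rewrite preE.
rewrite (eq_bigr (fun z => V a * (mass z * (z t == k)%:R))); last first.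
  by move=> z /Va ->; ring.
rewrite [RHS](eq_bigr (fun z => V a * arm_prob k (p t (witness a)) * mass z)); last first.
  by move=> z h; rewrite (Va z h) (pa z h); ring.
rewrite -!mulr_sumr -mulrA; congr (_ * _).
rewrite (_ : \sum_(z | pre z == a) mass z * (z t == k)%:R =
  \sum_(z | (pre z == a) && (z t == k)) mass z); last first.
  by rewrite big_mkcondr; apply: eq_bigr => z _; case: (z t == k); rewrite ?mulr1 ?mulr0.
rewrite !fine_mass_event.
have [aa|aa] := eqVneq (pre a) a; last first.
  have no w : pre w == a = false.
    apply/negP => /eqP e; move/eqP: aa; apply; rewrite -e.
    by apply/ffunP => s; rewrite !ffunE; case: (s < t)%N.
  rewrite (_ : [set w | _] = set0); last by apply/seteqP; split => w //=; rewrite no.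
  rewrite (_ : [set w | _] = set0); last by apply/seteqP; split => w //=; rewrite no.
  by rewrite measure0 mulr0.
have cylE w : (pre (realised w) == a) <-> cylinder t a w.
  split => [/eqP <- s st|h]; first by rewrite preE// ffunE.
  apply/eqP/ffunP => s; rewrite -aa !ffunE; case: (ltnP s t) => //= st; exact: h.
have -> : [set w | pre (realised w) == a] = cylinder t a.
  by apply/seteqP; split => w /cylE.
have -> : [set w | (pre (realised w) == a) && (realised w t == k)] =
   [set w | Z t w = k] `&` cylinder t a.
  apply/seteqP; split => w /=.
    by move=> /andP[/cylE ? /eqP]; rewrite ffunE.
  by move=> [h /cylE ->]; rewrite ffunE h eqxx.
rewrite (@cond_arm_prob _ _ _ (witness a)); last by move=> s _; rewrite witness_arm.
by rewrite fineM// fin_num_measure//; exact: measurable_cylinder.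
Qed.

End DesignLaw.

(** * Bounds at a fixed horizon *)

(** The square root is Lipschitz away from 0, and truncating a at 0 only brings it
    closer to e ^ 2. *)
Lemma sqrt_perturb (R : realType) (c0 a e del : R) : 0 < c0 -> c0 <= e -> `|a - e ^+ 2| <= del ->
  `|Num.sqrt (Num.max a 0) - e| <= del / c0.
Proof.
move=> c00 ce hd; set s := Num.sqrt _.
have e0 : 0 < e by exact: lt_le_trans ce.
have s0 : 0 <= s by exact: sqrtr_ge0.
have s2 : s ^+ 2 = Num.max a 0 by rewrite sqr_sqrtr// le_max lexx orbT.
rewrite ler_pdivlMr//.
have h1 : `|s - e| * (s + e) <= del.
  have -> : `|s - e| * (s + e) = `|s ^+ 2 - e ^+ 2|.
    by rewrite subr_sqr normrM [X in _ = _ * X]ger0_norm// addr_ge0// ltW.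
  apply: le_trans hd; rewrite s2 maxElt; case: ltP => // a0.
  have e20 : 0 <= e ^+ 2 by exact: sqr_ge0.
  rewrite ler0_norm; last lra.
  rewrite ler0_norm; lra.
apply: le_trans h1; rewrite ler_wpM2l//; lra.
Qed.

Section FixedHorizon.
Variables (R : realType) (b1 b2 b3 : R) (phi : R -> R).
Hypothesis b10 : 0 < b1.
Hypothesis hphi : sigmoid_condition b1 b2 b3 phi.
Variables (T d : nat) (x : 'I_T -> 'cV[R]_d) (y : 'I_T -> bool -> R).
Local Notation path := {ffun 'I_T -> bool}.
Variables (m : path -> R) (p : path -> 'I_T -> R).
Variable beta : path -> bool -> 'I_T -> 'cV[R]_d.
Hypothesis L : assignment_law m p.
Hypothesis F : forall z : path, sigmoid_ftrl phi x y z (p z) (beta z).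
Local Notation Ex := (expect m).
Variables c0 c1 c2 c3 : R.
Hypothesis T0 : (0 < T)%N.
Hypothesis c00 : 0 < c0.
Hypothesis c10 : 0 < c1.
Hypothesis c20 : 0 < c2.
Hypothesis c30 : 0 < c3.
Hypothesis hs : c2^-1 <= sigma_min (T%:R^-1 *: \sum_(s < T) (x s *m (x s)^T)).
Hypothesis hres : forall k, c0 <= min_residual x y k <= c1.
Hypothesis hY2 : forall k, \sum_t y t k ^+ 2 <= c1 ^+ 2 * T%:R.
Hypothesis hY4 : forall k, \sum_t y t k ^+ 4 <= c1 ^+ 4 * T%:R.
(* tau and alpha are the fourth root of T and the sixth root of r / sqrt T: with
   them all rates are integer powers, and the target rate is alpha ^ 5. *)
Let tau : R := Num.sqrt (Num.sqrt T%:R).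
Let r : R := covariate_radius x.
Hypothesis hr : r <= c3 * tau.
Variable alpha : R.
Hypothesis alpha0 : 0 < alpha.
Hypothesis alphaE : alpha ^+ 6 * tau ^+ 2 = r.

Variable kap : R.
Hypothesis kapE : 5 / sigmoid_slope phi = kap.
Let Cr : R := 1 + Num.sqrt c2.

Let kap0 : 0 < kap.
Proof. by rewrite -kapE divr_gt0// (sigmoid_slope_gt0 hphi). Qed.

Let tau2 : tau ^+ 2 = Num.sqrt T%:R.
Proof. by rewrite sqr_sqrtr// sqrtr_ge0. Qed.

Let tau4 : tau ^+ 4 = T%:R.
Proof. by rewrite (exprM tau 2 2) tau2 sqr_sqrtr. Qed.

Let tau1 : 1 <= tau.
Proof.
rewrite -(@ler_pXn2r _ 4) ?nnegrE ?sqrtr_ge0// tau4 expr1n.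
by rewrite -[1]/(1%:R) ler_nat.
Qed.

Let tau0 : 0 < tau.
Proof. exact: lt_le_trans tau1. Qed.

Let Cr1 : 1 <= Cr.
Proof. by rewrite lerDl sqrtr_ge0. Qed.

Let r0 : 0 <= r.
Proof. exact: covariate_radius_ge0. Qed.

Let radius_le t : running_radius x t <= Cr * r.
Proof.
apply: le_trans (running_radius_le x t) _; rewrite -/r.
have h1 : 1 <= Num.sqrt c2 * r.
  rewrite -(@ler_pXn2r _ 2) ?nnegrE//; last by rewrite mulr_ge0 ?sqrtr_ge0.
  by rewrite expr1n exprMn sqr_sqrtr ?(ltW c20)// (covariate_radius_lower T0 c20 hs).
have := r0; rewrite /Cr maxElt; case: ltP => *; lra.
Qed.

(** Above this value of tau, the choices h = Cr c3 / tau and a = tau satisfy h <= 1/2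
    and give the loss on the right of [expect_total_loss_le] a coefficient at most 1/2. *)
Definition burn_in : R := 2 * (Cr * c3) + 8 * (Cr * c3) * c1 ^+ 2 * b1 * kap.

Definition loss_constant : R := 2 * (2 * c1 ^+ 2 + 4 * (Cr * c3) * c1 ^+ 2 * (2 + b1)).

Lemma expect_total_loss_linear : burn_in <= tau ->
  Ex (total_loss x y p beta) <= loss_constant * T%:R.
Proof.
rewrite /burn_in /loss_constant; move HE : (Cr * c3) => H hburn; set S := Ex _.
have S0 : 0 <= S by apply: (expect_ge0 L); exact: (total_loss_ge0 x y beta L).
have H0 : 0 < H by rewrite -HE mulr_gt0// (lt_le_trans _ Cr1).
have c1b : 0 < c1 ^+ 2 by rewrite exprn_gt0.
have p1 : 0 <= 8 * H * c1 ^+ 2 * b1 * kap.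
  by rewrite mulr_ge0 ?(ltW kap0)// !mulr_ge0// ltW.
pose h := H / tau.
have h0 : 0 < h by rewrite divr_gt0.
have h2 : h <= 2^-1.
  rewrite /h ler_pdivrMr//; move: hburn; lra.
have hx t : enorm (x t) ^+ 2 <= h * (eta x t)^-1.
  have Rt1 := running_radius_ge1 x t.
  have Rt0 : 0 <= running_radius x t by apply: le_trans Rt1.
  rewrite inv_eta -tau2.
  have -> : h * (tau ^+ 2 * running_radius x t) = (H * tau) * running_radius x t.
    by rewrite /h; field; rewrite gt_eqF.
  rewrite expr2; apply: ler_pM; rewrite ?enorm_ge0 ?running_radius_ge//.
  apply: le_trans (running_radius_ge x t) _; apply: le_trans (radius_le t) _.
  by rewrite -HE -mulrA ler_wpM2l// (le_trans _ Cr1).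
have := expect_total_loss_le b10 hphi L F h0 h2 tau0 hx hY2.
rewrite -/S kapE -tau2 -tau4.
have -> : 2 * (c1 ^+ 2 * tau ^+ 4) + 4 * h * (c1 ^+ 2 * tau ^+ 4) *
    (2 + b1 * tau + b1 * kap / (tau ^+ 3 * tau ^+ 2) * S) =
    2 * c1 ^+ 2 * tau ^+ 4 + 4 * H * c1 ^+ 2 * (2 * tau ^+ 3 + b1 * tau ^+ 4) +
    (8 * H * c1 ^+ 2 * b1 * kap / tau) / tau * (S / 2).
  by rewrite /h; field; rewrite gt_eqF.
move=> hS.
have q1 : 8 * H * c1 ^+ 2 * b1 * kap / tau <= 1.
  rewrite ler_pdivrMr// mul1r; move: hburn; lra.
have q2 : (8 * H * c1 ^+ 2 * b1 * kap / tau) / tau * (S / 2) <= S / 2.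
  rewrite ler_piMl//; first by rewrite divr_ge0.
  by rewrite ler_pdivrMr// mul1r (le_trans q1).
have q3 : tau ^+ 3 <= tau ^+ 4 by rewrite (exprS tau 3) ler_peMl// exprn_ge0// ltW.
have q4 : 4 * H * c1 ^+ 2 * (2 * tau ^+ 3 + b1 * tau ^+ 4) <=
   4 * H * c1 ^+ 2 * ((2 + b1) * tau ^+ 4).
  apply: ler_wpM2l; first by rewrite !mulr_ge0// ltW.
  lra.
lra.
Qed.

Section Threshold.
Variable lam : R.
Hypothesis lam0 : 0 < lam.
Let K : R := lam * T%:R.

Definition prob_constant : R :=
  2 * (Cr ^+ 2 * (1 + c3)) + b1 * (1 + kap * lam * Cr ^+ 7 * (1 + c3)).

Let c31 : 0 <= 1 + c3.
Proof. by rewrite addr_ge0// ltW. Qed.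

Let alpha2 : alpha ^+ 2 <= 1 + c3.
Proof.
have h6 : alpha ^+ 6 <= c3.
  rewrite -(@ler_pM2r _ (tau ^+ 2)) ?exprn_gt0// alphaE.
  apply: le_trans hr _; rewrite ler_pM2l// expr2 ler_peMr//; exact: ltW.
have [a1|a1] := leP alpha 1.
  by rewrite (le_trans (y := 1))// ?lerDl ?(ltW c30)// expr_le1// ltW.
have : alpha ^+ 2 <= alpha ^+ 6 by rewrite ler_eXn2l.
lra.
Qed.

(** With q the running radius, q^2 u has fourth power (q u^4) q^7, and q u^4 is at
    most a multiple of tau^2 below the loss threshold.  This gives alpha^42 tau^16,
    slightly better than the alpha^40 tau^16 that the rate needs. *)
Lemma weighted_inv_prob_le k (z : path) t :
  loss_before x y p beta t z <= K ->
  (arm_prob k (p z t))^-1 * running_radius x t ^+ 2 <=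
  prob_constant * (alpha ^+ 10 * T%:R).
Proof.
move=> hz; set q := running_radius x t.
have q1 : 1 <= q := running_radius_ge1 x t.
have q0 : 0 < q := lt_le_trans ltr01 q1.
have qr : q <= Cr * (alpha ^+ 6 * tau ^+ 2) by rewrite alphaE; exact: radius_le.
have [u [u0 hu hk]] := inv_prob_bound b10 hphi L F z t.
rewrite -/q kapE -tau2 in hu.
have Cr0 : 0 <= Cr := le_trans ler01 Cr1.
have a0 := ltW alpha0; have t0 := ltW tau0.
have u4 : q * u ^+ 4 <= kap * lam * tau ^+ 2.
  rewrite -(@ler_pM2l _ (tau ^+ 2)) ?exprn_gt0// mulrA; apply: le_trans hu _.
  have -> : tau ^+ 2 * (kap * lam * tau ^+ 2) = kap * K by rewrite /K -tau4; ring.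
  by rewrite ler_wpM2l// ltW.
have sq : q ^+ 2 <= Cr ^+ 2 * (1 + c3) * (alpha ^+ 10 * T%:R).
  apply: (@le_trans _ _ ((Cr * (alpha ^+ 6 * tau ^+ 2)) ^+ 2)).
    rewrite ler_pXn2r// ?nnegrE ?(ltW q0)//.
    by rewrite !mulr_ge0// exprn_ge0.
  have -> : (Cr * (alpha ^+ 6 * tau ^+ 2)) ^+ 2 =
    Cr ^+ 2 * alpha ^+ 2 * (alpha ^+ 10 * T%:R) by rewrite -tau4; ring.
  apply: ler_wpM2r; first by rewrite mulr_ge0// exprn_ge0.
  by rewrite ler_wpM2l// sqr_ge0.
set D := 1 + kap * lam * Cr ^+ 7 * (1 + c3).
have D1 : 1 <= D.
  rewrite lerDl mulr_ge0// mulr_ge0 ?exprn_ge0//.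
  by rewrite mulr_ge0 ?(ltW kap0) ?(ltW lam0).
have uq : u * q ^+ 2 <= D * (alpha ^+ 10 * T%:R).
  have rhs0 : 0 <= D * (alpha ^+ 10 * T%:R).
    by rewrite mulr_ge0 ?(le_trans ler01 D1)// mulr_ge0// exprn_ge0.
  rewrite -(@ler_pXn2r _ 4) ?nnegrE// ?mulr_ge0 ?exprn_ge0// ?(ltW q0)//.
  have -> : (u * q ^+ 2) ^+ 4 = (q * u ^+ 4) * q ^+ 7 by ring.
  apply: (@le_trans _ _ ((kap * lam * tau ^+ 2) * (Cr * (alpha ^+ 6 * tau ^+ 2)) ^+ 7)).
    apply: ler_pM => //.
    - by rewrite mulr_ge0 ?exprn_ge0// ltW.
    - by rewrite exprn_ge0// ltW.
    - rewrite ler_pXn2r// ?nnegrE ?(ltW q0)//.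
      by rewrite !mulr_ge0// exprn_ge0.
  have -> : (kap * lam * tau ^+ 2) * (Cr * (alpha ^+ 6 * tau ^+ 2)) ^+ 7 =
     (kap * lam * Cr ^+ 7 * alpha ^+ 2) * (alpha ^+ 10 * T%:R) ^+ 4.
    by rewrite -tau4; ring.
  rewrite [X in _ <= X]exprMn; apply: ler_wpM2r.
    by rewrite exprn_ge0// mulr_ge0// exprn_ge0.
  apply: (@le_trans _ _ D); last exact: ler_eXnr.
  apply: (@le_trans _ _ (kap * lam * Cr ^+ 7 * (1 + c3))); last by rewrite lerDr.
  apply: ler_wpM2l => //.
  by rewrite mulr_ge0 ?exprn_ge0// mulr_ge0// ltW.
apply: (@le_trans _ _ ((2 + b1 * u) * q ^+ 2)).
  by rewrite ler_wpM2r ?sqr_ge0.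
rewrite /prob_constant -/D.
have := ler_wpM2l (ltW b10) uq.
set e := alpha ^+ 10 * T%:R in sq uq *; lra.
Qed.

Definition error_constant : R := prob_constant * c1 ^+ 4 *
  (16 + 16 * c2 + 8 * c2 ^+ 2 * (prob_constant * (1 + c3) ^+ 5)).

Let Cr0 : 0 <= Cr.
Proof. exact: le_trans Cr1. Qed.

Lemma prob_constant_ge0 : 0 <= prob_constant.
Proof.
rewrite /prob_constant addr_ge0//; first by rewrite !mulr_ge0.
rewrite mulr_ge0 ?(ltW b10)// addr_ge0// !mulr_ge0 ?exprn_ge0//; exact: ltW.
Qed.

Let alpha10 : alpha ^+ 10 <= (1 + c3) ^+ 5.
Proof.
by rewrite (exprM alpha 2 5) ler_pXn2r// nnegrE sqr_ge0.
Qed.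

Lemma expect_stopped_error_le k :
  Ex (fun z => stopped_error x y p beta K k z ^+ 2) <=
  error_constant * (alpha ^+ 5 * T%:R) ^+ 2.
Proof.
set V := prob_constant * (alpha ^+ 10 * T%:R).
have a10 : 0 <= alpha ^+ 10 by rewrite exprn_ge0// ltW.
have V0 : 0 <= V by rewrite mulr_ge0 ?prob_constant_ge0// mulr_ge0.
have Tp : (0 : R) < T%:R by rewrite ltr0n.
apply: le_trans (expect_stopped_error_sqr L F T0 c20 hs V0
  (@weighted_inv_prob_le k) (hY2 k) (hY4 k)) _.
have -> : V * (16 * (c1 ^+ 4 * T%:R) + 16 * (c2 / T%:R) * (c1 ^+ 2 * T%:R) ^+ 2 +
    8 * (c2 / T%:R) ^+ 2 * V * (c1 ^+ 2 * T%:R) ^+ 2) =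
  prob_constant * c1 ^+ 4 * (16 + 16 * c2 +
    8 * c2 ^+ 2 * (prob_constant * alpha ^+ 10)) * (alpha ^+ 5 * T%:R) ^+ 2.
  by rewrite /V; field; rewrite gt_eqF.
apply: ler_wpM2r; first exact: sqr_ge0.
apply: ler_wpM2l.
  by rewrite mulr_ge0 ?prob_constant_ge0// exprn_ge0// ltW.
rewrite lerD2l; apply: ler_wpM2l; first by rewrite mulr_ge0// sqr_ge0.
by apply: ler_wpM2l => //; exact: prob_constant_ge0.
Qed.

Lemma error_constant_ge0 : 0 <= error_constant.
Proof.
have h : 0 <= (1 + c3) ^+ 5 by rewrite exprn_ge0.
have hp := prob_constant_ge0.
rewrite /error_constant mulr_ge0//; first by rewrite mulr_ge0// exprn_ge0// ltW.
have h2 : 0 <= c2 ^+ 2 * (prob_constant * (1 + c3) ^+ 5).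
  by apply: mulr_ge0; [exact: sqr_ge0|exact: mulr_ge0].
have := c20; lra.
Qed.

Variable N : R.
Hypothesis N0 : 0 < N.

(** The stopped error divided by T is the error of the residual estimator as long as
    the loss stays below its threshold. *)
Definition typical (z : path) : bool := [&& total_loss x y p beta z <= K,
  stopped_error x y p beta K true z ^+ 2 <= (N * (alpha ^+ 5 * T%:R)) ^+ 2
  & stopped_error x y p beta K false z ^+ 2 <= (N * (alpha ^+ 5 * T%:R)) ^+ 2].

Lemma atypical_mass : burn_in <= tau ->
  \sum_(z | ~~ typical z) m z <=
  loss_constant / lam + 2 * (error_constant / N ^+ 2).
Proof.
move=> hburn; have Tp : (0 : R) < T%:R by rewrite ltr0n.
pose a := alpha ^+ 5 * T%:R.
have ap : 0 < a by rewrite mulr_gt0// exprn_gt0.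
have K0 : 0 < K by rewrite mulr_gt0.
have Na : 0 < (N * a) ^+ 2 by rewrite exprn_gt0// mulr_gt0.
have m0 := law_ge0 L.
have union (A B : pred path) : \sum_(z | A z || B z) m z <=
    \sum_(z | A z) m z + \sum_(z | B z) m z.
  rewrite (bigID A)/= [X in X + _ <= _](eq_bigl A); last first.
    by move=> z; case: (A z); case: (B z).
  rewrite lerD2l [X in _ <= X](bigID A)/=.
  rewrite [X in X <= _](eq_bigl (fun z => B z && ~~ A z)); last first.
    by move=> z; case: (A z); case: (B z).
  by rewrite lerDr sumr_ge0.
have e k : \sum_(z | (N * a) ^+ 2 < stopped_error x y p beta K k z ^+ 2) m z <=
    error_constant / N ^+ 2.
  apply: le_trans (expect_markov L Na (fun z => sqr_ge0 _)) _.
  rewrite ler_pdivrMr//; apply: le_trans (expect_stopped_error_le k) _.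
  rewrite -/a (_ : error_constant / N ^+ 2 * (N * a) ^+ 2 = error_constant * a ^+ 2)//.
  by field; rewrite gt_eqF.
have l : \sum_(z | K < total_loss x y p beta z) m z <= loss_constant / lam.
  apply: le_trans (expect_markov L K0 (total_loss_ge0 x y beta L)) _.
  rewrite ler_pdivrMr//; apply: le_trans (expect_total_loss_linear hburn) _.
  rewrite /K mulrA divfK//; by rewrite gt_eqF.
rewrite (eq_bigl (fun z => (K < total_loss x y p beta z) ||
   (((N * a) ^+ 2 < stopped_error x y p beta K true z ^+ 2) ||
   ((N * a) ^+ 2 < stopped_error x y p beta K false z ^+ 2)))); last first.
  by move=> z; rewrite /typical !negb_and -!ltNge.
apply: le_trans (union _ _) _; apply: lerD => //.
apply: le_trans (union _ _) _; rewrite mulr_natl mulr2n; exact: lerD.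
Qed.

Definition rate_constant : R :=
  4 * ((2 * c1 + N * (1 + (1 + c3) ^+ 5) / c0) * (N / c0)).

Lemma typical_error (z : path) : typical z ->
  `|4 * hat_residual x y z (p z) true * hat_residual x y z (p z) false
    - 4 * min_residual x y true * min_residual x y false| <=
  rate_constant * alpha ^+ 5.
Proof.
move=> /and3P[hl ht hf]; have Tp : (0 : R) < T%:R by rewrite ltr0n.
have a5 : 0 < alpha ^+ 5 by rewrite exprn_gt0.
have err k : stopped_error x y p beta K k z ^+ 2 <= (N * (alpha ^+ 5 * T%:R)) ^+ 2 ->
    `|hat_residual x y z (p z) k - min_residual x y k| <= N * alpha ^+ 5 / c0.
  move=> h; have /andP[h0 _] := hres k; apply: sqrt_perturb => //.
  rewrite -(ler_pM2l Tp) -{1}(gtr0_norm Tp) -normrM.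
  rewrite (@hatA_error _ _ _ x y p beta c2 T0 c20 hs K k z); last first.
    by move=> t; apply: le_trans (loss_before_le x y beta L t z) hl.
  rewrite (_ : T%:R * (N * alpha ^+ 5) = N * (alpha ^+ 5 * T%:R)); last by ring.
  rewrite -(@ler_pXn2r _ 2) ?nnegrE// ?real_normK ?num_real//.
  by rewrite mulr_ge0 ?(ltW N0)// mulr_ge0// ltW.
have {ht}e1 := err true ht; have {hf}e0 := err false hf.
have /andP[_ m1] := hres true; have /andP[m00 m0] := hres false.
have a5le : alpha ^+ 5 <= 1 + (1 + c3) ^+ 5.
  have : 0 <= (alpha ^+ 5 - 1) ^+ 2 by exact: sqr_ge0.
  have -> : (alpha ^+ 5 - 1) ^+ 2 = alpha ^+ 10 - 2 * alpha ^+ 5 + 1 by ring.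
  have := alpha10; lra.
have s0 : 0 <= hat_residual x y z (p z) true by exact: sqrtr_ge0.
have c1p := c10; move: e1 e0 m1 m00 m0 s0.
set s1 := hat_residual _ _ _ _ true; set s0 := hat_residual _ _ _ _ false.
set f1 := min_residual _ _ true; set f0 := min_residual _ _ false.
set del := N * alpha ^+ 5 / c0 => e1 e0 m1 m00 m0 s10.
have del0 : 0 <= del by rewrite divr_ge0 ?(ltW c00)// mulr_ge0// ltW.
have -> : 4 * s1 * s0 - 4 * f1 * f0 = 4 * (s1 * (s0 - f0) + (s1 - f1) * f0) by ring.
rewrite normrM ger0_norm//.
have s1le : s1 <= c1 + N * (1 + (1 + c3) ^+ 5) / c0.
  have : del <= N * (1 + (1 + c3) ^+ 5) / c0.
    rewrite /del ler_wpM2r ?invr_ge0 ?(ltW c00)//.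
    by rewrite ler_wpM2l// ltW.
  have := ler_norm (s1 - f1); lra.
have f00 : 0 <= f0 by apply: le_trans m00; exact: ltW.
have -> : rate_constant * alpha ^+ 5 =
   4 * ((c1 + N * (1 + (1 + c3) ^+ 5) / c0) * del + del * c1).
  by rewrite /rate_constant /del; field; rewrite gt_eqF.
rewrite ler_wpM2l//; apply: le_trans (ler_normD _ _) _; rewrite !normrM.
by apply: lerD; apply: ler_pM => //; rewrite ger0_norm.
Qed.

End Threshold.
End FixedHorizon.

(** * The rate *)

Section Preparation.
Variable R : realType.

Lemma fourth_moment_le (c1 : R) (T d : nat) (c0 : R) (x : 'I_T -> 'cV[R]_d)
    (y : 'I_T -> bool -> R) k : (0 < T)%N -> 0 < c1 -> moment_bound c0 c1 x y ->
  \sum_t y t k ^+ 4 <= c1 ^+ 4 * T%:R.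
Proof.
move=> T0 c10 /(_ k)[_ _]; set X := T%:R^-1 * _ => h.
have Tp : (0 : R) < T%:R by rewrite ltr0n.
have X0 : 0 <= X.
  rewrite mulr_ge0 ?invr_ge0 ?(ltW Tp)// sumr_ge0// => t _.
  by rewrite (exprM _ 2 2) sqr_ge0.
have XE : (X `^ 4^-1) ^+ 4 = X.
  by rewrite -powR_mulrn ?powR_ge0// -powRrM mulVf// powRr1.
have : X <= c1 ^+ 4.
  by rewrite -XE ler_pXn2r// ?nnegrE ?powR_ge0// ltW.
by rewrite /X mulrC ler_pdivrMr.
Qed.

(** By the arithmetic-geometric mean inequality 2 v^2 <= c1^2 + v^4 / c1^2. *)
Lemma second_moment_le (c1 : R) (T : nat) (v : 'I_T -> R) : 0 < c1 ->
  \sum_t v t ^+ 4 <= c1 ^+ 4 * T%:R -> \sum_t v t ^+ 2 <= c1 ^+ 2 * T%:R.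
Proof.
move=> c10 h.
have le1 t : v t ^+ 2 <= (c1 ^+ 2 + v t ^+ 4 / c1 ^+ 2) / 2.
  rewrite ler_pdivlMr//.
  have -> : c1 ^+ 2 + v t ^+ 4 / c1 ^+ 2 =
      v t ^+ 2 * 2 + ((v t ^+ 2 - c1 ^+ 2) / c1) ^+ 2 by field; rewrite gt_eqF.
  by rewrite lerDl sqr_ge0.
apply: le_trans (ler_sum _ (fun t _ => le1 t)) _.
rewrite -mulr_suml big_split /= sumr_const card_ord -mulr_suml -mulr_natr.
suff : (\sum_t v t ^+ 4) / c1 ^+ 2 <= c1 ^+ 2 * T%:R by lra.
rewrite ler_pdivrMr ?exprn_gt0//; apply: le_trans h _.
by rewrite [X in _ <= X]mulrAC -exprD.
Qed.

Lemma powR_quarter (a : R) : 0 <= a -> a `^ (4^-1) = Num.sqrt (Num.sqrt a).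
Proof.
move=> a0; have -> : 4^-1 = 2^-1 * 2^-1 :> R by field.
by rewrite powRrM !powR12_sqrt ?powR_ge0 ?sqrtr_ge0.
Qed.

Lemma rate_root (a r : R) : 0 < a -> 0 < r ->
  exists2 alpha, 0 < alpha & alpha ^+ 6 * Num.sqrt (Num.sqrt a) ^+ 2 = r /\
    a `^ (- (5 / 12)) * r `^ (5 / 6) = alpha ^+ 5.
Proof.
move=> a0 r0; exists ((r / Num.sqrt a) `^ (6^-1)).
  by rewrite powR_gt0// divr_gt0// sqrtr_gt0.
have s0 : 0 < Num.sqrt a by rewrite sqrtr_gt0.
have q0 : 0 <= r / Num.sqrt a by rewrite divr_ge0// ltW.
split.
  rewrite -powR_mulrn ?powR_ge0// -powRrM mulVf// powRr1// sqr_sqrtr ?sqrtr_ge0//.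
  by rewrite divfK// gt_eqF.
rewrite -[RHS]powR_mulrn ?powR_ge0// -powRrM.
have -> : 6^-1 * 5%:R = 5 / 6 :> R by rewrite mulrC.
rewrite powRM ?invr_ge0 ?(ltW r0) ?(ltW s0)// mulrC; congr (_ * _).
rewrite -powR12_sqrt ?(ltW a0)// -powRN -powRrM; congr powR; by field.
Qed.

Lemma gram_bound (c2 gamma0 : R) (T d : nat) (x : 'I_T -> 'cV[R]_d) :
  (0 < T)%N -> 0 < gamma0 -> gamma0 ^+ 2 <= T%:R -> eigenvalue_bound c2 gamma0 x ->
  c2^-1 <= sigma_min (T%:R^-1 *: \sum_(s < T) (x s *m (x s)^T)).
Proof.
case: T x => // n x _ g0 hT /(_ ord_max) /=; rewrite (eq_bigl xpredT); last first.
  by move=> s; rewrite /= -ltnS ltn_ord.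
apply; rewrite -[X in _ <= X]sqr_sqrtr// expr2 ler_wpM2l ?sqrtr_ge0//.
by rewrite -(ler_pXn2r (n := 2))// ?nnegrE ?sqrtr_ge0 ?(ltW g0)// sqr_sqrtr.
Qed.

End Preparation.

Theorem corollary5p8 (R : realType)
    (c0 c1 c2 c3 gamma0 b1 b2 b3 : R)
    (hc0 : 0 < c0) (hc01 : c0 <= c1) (hc2 : 0 < c2) (hc3 : 0 < c3)
    (hgamma0 : 0 < gamma0) (hb1 : 0 < b1) (hb2 : 0 < b2) (hb3 : 0 < b3)
    (phi : R -> R) (hphi : sigmoid_condition b1 b2 b3 phi)
    (d : nat -> nat)
    (x : forall T : nat, 'I_T -> 'cV[R]_(d T))
    (y : forall T : nat, 'I_T -> bool -> R)
    (disp : nat -> measure_display)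
    (Omega : forall T : nat, measurableType (disp T))
    (P : forall T : nat, probability (Omega T) R)
    (Z : forall T : nat, 'I_T -> Omega T -> bool)
    (p : forall T : nat, 'I_T -> Omega T -> R)
    (beta : forall T : nat, bool -> 'I_T -> Omega T -> 'cV[R]_(d T))
    (hdesign : forall T : nat, gamma0 ^+ 2 <= T%:R ->
       sigmoid_ftrl_design phi (P T) (x T) (y T) (Z T) (p T) (beta T))
    (h1 : forall T : nat, gamma0 ^+ 2 <= T%:R ->
       moment_bound c0 c1 (x T) (y T))
    (h2 : forall T : nat, gamma0 ^+ 2 <= T%:R ->
       eigenvalue_bound c2 gamma0 (x T))
    (h3 : forall T : nat, gamma0 ^+ 2 <= T%:R -> radius_bound c3 (x T)) :
  bigOp P
    (fun (T : nat) (w : Omega T) =>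
       T%:R * hatVB (x T) (y T) (fun t => Z T t w) (fun t => p T t w)
       - T%:R * VB (x T) (y T))
    (fun T : nat => T%:R `^ (- (5 / 12)) * covariate_radius (x T) `^ (5 / 6)).
Proof.
move=> eps eps0.
have hc1 : 0 < c1 by exact: lt_le_trans hc01.
pose kap := 5 / sigmoid_slope phi.
have kap0 : 0 < kap by rewrite divr_gt0// (sigmoid_slope_gt0 hphi).
set LC := loss_constant b1 c1 c2 c3.
have H0 : 0 <= (1 + Num.sqrt c2) * c3.
  by rewrite mulr_ge0 ?(ltW hc3)// addr_ge0// sqrtr_ge0.
have LC0 : 0 <= LC.
  have a0 : 0 <= c1 ^+ 2 by exact: sqr_ge0.
  have b0 : 0 <= (1 + Num.sqrt c2) * c3 * c1 ^+ 2 * (2 + b1).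
    by apply: mulr_ge0; [exact: mulr_ge0|rewrite addr_ge0// ltW].
  rewrite /LC /loss_constant; lra.
(* lam and N make the Markov bounds of [atypical_mass] add up to eps. *)
pose lam := 2 * LC / eps + 1.
have lam0 : 0 < lam by rewrite ltr_wpDl// divr_ge0 ?(ltW eps0)// mulr_ge0.
set EC := error_constant b1 c1 c2 c3 kap lam.
have EC0 : 0 <= EC by exact: (error_constant_ge0 hb1 hphi hc1 hc2 hc3 (erefl kap)).
pose N := 4 * EC / eps + 1.
have N1 : 1 <= N by rewrite lerDr divr_ge0 ?(ltW eps0)// mulr_ge0.
have N0 : 0 < N by exact: lt_le_trans N1.
set M := rate_constant c0 c1 c3 N.
have M0 : 0 < M.
  have c30 : 0 <= (1 + c3) ^+ 5 by rewrite exprn_ge0// addr_ge0// ltW.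
  have q0 : 0 <= N * (1 + (1 + c3) ^+ 5) / c0.
    by rewrite divr_ge0 ?(ltW hc0)// mulr_ge0 ?(ltW N0)// addr_ge0.
  rewrite /M /rate_constant mulr_gt0// mulr_gt0// ?divr_gt0//.
  by rewrite ltr_wpDr// mulr_gt0.
have total_le : LC / lam + 2 * (EC / N ^+ 2) <= eps.
  have e1 : LC / lam <= eps / 2.
    rewrite ler_pdivrMr// /lam.
    have -> : eps / 2 * (2 * LC / eps + 1) = LC + eps / 2 by field; rewrite gt_eqF.
    by rewrite lerDl divr_ge0// ltW.
  have e2 : EC / N ^+ 2 <= eps / 4.
    rewrite ler_pdivrMr ?exprn_gt0//; apply: (@le_trans _ _ (eps / 4 * N)).
      rewrite /N (_ : eps / 4 * _ = EC + eps / 4); last by field; rewrite gt_eqF.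
      by rewrite lerDl divr_ge0// ltW.
    rewrite ler_wpM2l ?divr_ge0 ?(ltW eps0)//.
    by rewrite expr2 ler_peMl// ltW.
  lra.
exists M => //.
near=> T.
have hT : gamma0 ^+ 2 <= T%:R by near: T; exact: nbhs_infty_ger.
have T0 : (0 < T)%N by near: T; exact: nbhs_infty_gt.
have hburn : burn_in b1 c1 c2 c3 kap <= Num.sqrt (Num.sqrt T%:R).
  have h : burn_in b1 c1 c2 c3 kap ^+ 4 <= T%:R by near: T; exact: nbhs_infty_ger.
  apply: le_trans (ler_norm _) _.
  rewrite -(@ler_pXn2r _ 4) ?nnegrE ?sqrtr_ge0// (exprM (Num.sqrt _) 2 2).
  rewrite !sqr_sqrtr ?sqrtr_ge0// -normrX ger0_norm//.
  by rewrite (exprM _ 2 2) sqr_ge0.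
have [mZ hF cp] := hdesign T hT.
have p01 t w : 0 < p T t w < 1.
  by have [_ [+ _]] := hF w t; rewrite /= in_itv.
have L := mass_law mZ cp p01.
set om := witness mZ cp p01 in L.
have F (z : {ffun 'I_T -> bool}) : sigmoid_ftrl phi (x T) (y T) z (fun t => p T t (om z))
    (fun k t => beta T k t (om z)).
  have := hF (om z); congr sigmoid_ftrl; apply/funext => t; exact: witness_arm.
have hs := gram_bound T0 hgamma0 hT (h2 T hT).
have hr : covariate_radius (x T) <= c3 * Num.sqrt (Num.sqrt T%:R).
  by have := h3 T hT; rewrite /radius_bound powR_quarter.
have Y4 k := fourth_moment_le k T0 hc1 (h1 T hT).
have Y2 k := second_moment_le hc1 (Y4 k).
have hres k : c0 <= min_residual (x T) (y T) k <= c1.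
  have [-> mb cb] := h1 T hT k; exact: le_trans cb.
have r0 : 0 < covariate_radius (x T).
  rewrite lt_neqAle covariate_radius_ge0// andbT eq_sym; apply/eqP => r0.
  by have := covariate_radius_lower T0 hc2 hs; rewrite r0 expr0n mulr0 ler10.
have [alpha alpha0 [alphaE ->]] : exists2 alpha, 0 < alpha &
    alpha ^+ 6 * Num.sqrt (Num.sqrt T%:R) ^+ 2 = covariate_radius (x T) /\
    T%:R `^ (- (5 / 12)) * covariate_radius (x T) `^ (5 / 6) = alpha ^+ 5.
  by apply: rate_root => //; rewrite ltr0n.
pose W (z : {ffun 'I_T -> bool}) := T%:R * hatVB (x T) (y T) z (fun t => p T t (om z))
       - T%:R * VB (x T) (y T).
have Zw w : (fun t => Z T t w) = realised (Z T) w by apply/funext => t; rewrite ffunE.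
have pw w : (fun t => p T t w) = (fun t => p T t (om (realised (Z T) w))).
  apply/funext => t; apply: (prob_past cp) => s _.
  by rewrite /om witness_arm ffunE.
have -> : [set w | M * alpha ^+ 5 < `|T%:R * hatVB (x T) (y T)
      (fun t => Z T t w) (fun t => p T t w) - T%:R * VB (x T) (y T)|] =
    [set w | [pred z | M * alpha ^+ 5 < `|W z|] (realised (Z T) w)].
  apply: eq_set => w /=; by rewrite /W Zw pw.
rewrite (mass_event _ mZ) lee_fin; apply: le_trans total_le.
apply: le_trans (atypical_mass hb1 hphi L F T0 hc1 hc2 hc3 hs Y2 Y4 hr
  alpha0 alphaE (erefl kap) lam0 N0 hburn).
rewrite [X in X <= _]big_mkcond [X in _ <= X]big_mkcond /=.
apply: ler_sum => z _; case: ifP => [hz|_]; last first.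
  by case: ifP => // _; exact: (law_ge0 L).
rewrite ifT//; apply: contraTN hz => typ; rewrite -leNgt.
have -> : W z = 4 * hat_residual (x T) (y T) z (fun t => p T t (om z)) true *
    hat_residual (x T) (y T) z (fun t => p T t (om z)) false
    - 4 * min_residual (x T) (y T) true * min_residual (x T) (y T) false.
  have Tn : T%:R != 0 :> R by rewrite pnatr_eq0 -lt0n.
  by rewrite /W /hatVB /VB; field.
exact: (typical_error L T0 hc0 hc1 hc2 hc3 hs hres hr alpha0 alphaE N0 typ).
Unshelve. all: by end_near.
Qed.
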